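(* Let $b\in[H^\infty_d\otimes\mathscr L(\mathcal H)]_1$ be purely contractive. The orthogonal projection $P_0$ of $Q^2(b)$ onto $P^2_0(b)$ is semi-invariant for $R=\pi_b(L)$, i.e. $P_0R_kP_0R_jP_0=P_0R_kR_jP_0$ for all $1\le j,k\le d$, and the completely positive map $\nu_b:\mathcal A+\mathcal A^*\to\mathscr L(\mathcal H)$ is a tight extension of $\mu_b:\mathcal S+\mathcal S^*\to\mathscr L(\mathcal H)$.
   Context: Let $d\ge1$ and let $\mathcal H$ be a non-zero complex Hilbert space, finite dimensional or separable; inner products are conjugate linear in the first argument; $\bigvee$ denotes closed linear span; $\mathbb B^d$ is the open unit ball of $\mathbb C^d$, $zw^*:=\sum_jz_j\overline{w_j}$. For a row operator $T=(T_1,\dots,T_d):\mathcal J\otimes\mathbb C^d\to\mathcal J$ write $zT^*=\sum_jz_jT_j^*$, $Tz^*=\sum_j\overline{z_j}T_j$, and $T^\alpha=T_{i_1}\cdots T_{i_k}$ for a word $\alpha=i_1\cdots i_k$ in the free unital semigroup $\mathbb F^d$ on $d$ letters ($T^\emptyset=I$). For a vector-valued reproducing kernel Hilbert space with kernel $K(z,w)\in\mathscr L(\mathcal H)$, $K_w:\mathcal H\to\mathcal H(K)$ denotes the adjoint of evaluation at $w$, so $K(z,w)=K_z^*K_w$. $[H^\infty_d\otimes\mathscr L(\mathcal H)]_1$ is the closed unit ball of the multiplier algebra of the space $H^2_d\otimes\mathcal H$ with kernel $\frac{1}{1-zw^*}I_{\mathcal H}$ on $\mathbb B^d$; $b$ is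 purely contractive if $\|b(z)\|<1$ for all $z\in\mathbb B^d$. Put $H_b(z)=(I-b(z))^{-1}(I+b(z))$ and let the Herglotz space $\mathscr L(b)$ be the reproducing kernel Hilbert space with kernel $K(z,w)=K^b(z,w)=\frac12\frac{H_b(z)+H_b(w)^*}{1-zw^*}$. $V=V^b:\mathscr L(b)\otimes\mathbb C^d\to\mathscr L(b)$ is the partial isometry with initial space $\bigvee_{w\in\mathbb B^d,h\in\mathcal H}w^*K_wh$, where $w^*K_wh=(\overline{w_1}K_wh,\dots,\overline{w_d}K_wh)^T$, given there by $V(w^*K_wh)=(K_w-K_0)h$. $L=(L_1,\dots,L_d)$ are the left creation operators on the full Fock space over $\mathbb C^d$; $\mathcal A$ is the unital norm-closed algebra they generate; $\mathcal S\subset\mathcal A$ is the norm-closed span of $\{(I-Lz^* )^{-1}:z\in\mathbb B^d\}$, equivalently of the symmetrized monomials $L^{\mathbf n}=\sum_{\lambda(\alpha)=\mathbf n}L^\alpha$, $\mathbf n\in\mathbb N^d$ ($\lambda$ counts the occurrences of each letter). $\mathcal S+\mathcal S^*$ and $\mathcal A+\mathcal A^*$ denote norm closures of these sums; $\mathcal S^*\mathcal S\subset\mathcal S+\mathcal S^*$ and $\mathcal A^*\mathcal A\subset\mathcal A+\mathcal A^*$. $\mu_b$ is the completely positive map with $\mu_b((I-zL^* )^{-1}(I-Lw^* )^{-1})=K^b(z,w)$; it satisfies $\mu_b(L^{\mathbf n})=K_0^*V^{\mathbf n}K_0$ ($V^{\mathbf n}=\sum_{\lambda(\alpha)=\mathbf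 n}V^\alpha$). $\nu=\nu_b$ is the completely positive map on $\mathcal A+\mathcal A^*$ with $\nu_b(L^\alpha)=K_0^*V^\alpha K_0$, $\alpha\in\mathbb F^d$; it extends $\mu_b$. For a completely positive extension $\phi:\mathcal A+\mathcal A^*\to\mathscr L(\mathcal H)$ of $\mu_b$, $Q^2(\phi)$ is the Hilbert space completion of $\mathcal A\otimes\mathcal H$ modulo null vectors for $\langle a\otimes h,c\otimes g\rangle_\phi=\langle h,\phi(a^*c)g\rangle$, and $\pi_\phi(a)(c\otimes h)=ac\otimes h$ defines a unital homomorphism $\pi_\phi:\mathcal A\to\mathscr L(Q^2(\phi))$ with $\pi_\phi(L)=(\pi_\phi(L_1),\dots,\pi_\phi(L_d))$ a row isometry. $P^2_0(\phi):=\bigvee_{\mathbf n\ne0,h\in\mathcal H}L^{\mathbf n}\otimes h$ and $Q^2_0(\phi):=\bigvee_{\alpha\ne\emptyset,h\in\mathcal H}L^\alpha\otimes h$ are subspaces of $Q^2(\phi)$. Let $P_0$ be the projection onto $P^2_0(\phi)$, $T_j=\pi_\phi(L_j)|_{Q^2_0(\phi)}$, and $S_j=P_0\pi_\phi(L_j)|_{P^2_0(\phi)}$. The extension $\phi$ is called tight if $T$ is a dilation of $S$, i.e. $S^\alpha=P_0T^\alpha|_{P_0^2(\phi)}$ for all $\alpha\in\mathbb F^d$. Write $Q^2(b)=Q^2(\nu_b)$, $P^2_0(b)=P^2_0(\nu_b)$, $\pi_b=\pi_{\nu_b}$, $R_j=\pi_b(L_j)$. *)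

(* Defs.v *)
From HB Require Import structures.
From mathcomp Require Import all_boot all_order all_algebra.
From mathcomp Require Import sesquilinear.
From mathcomp Require Import complex.
From mathcomp Require Import all_classical all_reals all_analysis.

Set Implicit Arguments.
Unset Strict Implicit.
Unset Printing Implicit Defensive.

Import Order.TTheory GRing.Theory Num.Theory numFieldNormedType.Exports.
Local Open Scope classical_set_scope.
Local Open Scope ring_scope.
Local Open Scope complex_scope.

(* The library form [inner] is linear in its first argument; see [ip]. *)
HB.mixin Record isHilbert (R : realType) (U : Type)
    & CompleteNormedModule R[i] U := {
  inner : {dot U for (@Num.conj R[i])};
  normsq_inner : forall x : U, `|x| ^+ 2 = inner x x }.

#[short(type="hilbertType")]
HB.structure Definition Hilbert (R : realType) :=
  {U of CompleteNormedModule R[i] U & isHilbert R U}.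

Section Operators.
Context {R : realType}.
Implicit Types U V : hilbertType R.

(* Inner product, conjugate linear in the first argument. *)
Definition ip U (x y : U) : R[i] := inner y x.

Definition separable U := exists D : set U, countable D /\ dense D.

(* Operators are plain functions; bop is the set of bounded linear ones. *)
Definition bop U V : set (U -> V) := [set f | linear f /\ continuous f].

(* The Hilbert space adjoint of a bounded operator (unique, and it exists by
   the Riesz representation theorem); 0 if f has no adjoint. *)
Definition adj U V (f : U -> V) : V -> U :=
  xget 0 [set g | forall x y, ip (f x) y = ip x (g y)].

(* The bounded two-sided inverse; 0 if f is not invertible. *)
Definition opinv U (f : U -> U) : U -> U :=
  xget 0 [set g | bop g /\ f \o g = id /\ g \o f = id].

(* The orthogonal projection onto a closed subspace M. *)
Definition orthproj U (M : set U) (x : U) : U :=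
  xget 0 [set y | M y /\ forall m, M m -> ip m (x - y) = 0].

(* Closure in the operator norm. *)
Definition opclosure U V (X : set (U -> V)) : set (U -> V) :=
  [set f | bop f /\ forall e : R, 0 < e ->
    exists2 g, X g & forall x, `|f x - g x| <= e%:C * `|x|].

Definition lspan (K : nzRingType) (E : lmodType K) (X : set E) : set E :=
  [set x | exists n (c : 'I_n -> K) (v : 'I_n -> E),
     (forall i, X (v i)) /\ x = \sum_i c i *: v i].

Definition closed_span U (X : set U) : set U := closure (lspan X).

Definition unital_closed_algebra U (X : set (U -> U)) :=
  [/\ X `<=` bop (V:=U), X id,
      forall (c : R[i]) f g, X f -> X g -> X (c *: f + g),
      forall f g, X f -> X g -> X (f \o g)
    & opclosure X `<=` X].

Definition generated_algebra U (X : set (U -> U)) : set (U -> U) :=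
  smallest (@unital_closed_algebra U) X.

(* For X = A this is the norm closure of A + A^*. *)
Definition opsys U (X : set (U -> U)) : set (U -> U) :=
  opclosure [set a + adj c | a in X & c in X].

Definition completely_positive U V (E : set (U -> U))
    (phi : (U -> U) -> V -> V) :=
  [/\ forall a, E a -> bop (phi a),
      forall (c : R[i]) a a', E a -> E a' ->
        phi (c *: a + a') = c *: phi a + phi a'
    & forall n (a : 'I_n -> 'I_n -> U -> U), (forall i j, E (a i j)) ->
        (forall x : 'I_n -> U, 0 <= \sum_i \sum_j ip (x i) (a i j (x j))) ->
        forall y : 'I_n -> V,
          0 <= \sum_i \sum_j ip (y i) (phi (a i j) (y j))].

Section Tuples.
Variables (d : nat) (U : hilbertType R).
Implicit Types T : 'I_d -> U -> U.

Definition opword T (alpha : seq 'I_d) : U -> U :=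
  foldr (fun i f => T i \o f) id alpha.

(* T^n for a multi-index n: the sum of T^alpha over the words alpha in which
   each letter j occurs n j times. *)
Definition opsym T (n : 'I_d -> nat) : U -> U :=
  \sum_(alpha : (\sum_i n i)%N.-tuple 'I_d | [forall i, count_mem i alpha == n i])
    opword T alpha.

(* T z^* and z T^* *)
Definition op_conj T (z : 'rV[R[i]]_d) : U -> U := \sum_i (z 0 i)^* *: T i.
Definition conj_op T (z : 'rV[R[i]]_d) : U -> U := \sum_i z 0 i *: adj (T i).

(* An element of U \otimes C^d is a family 'I_d -> U; the topology of
   pointwise convergence is the norm topology of the direct sum. *)
Definition row_op T (f : 'I_d -> U) : U := \sum_i T i (f i).

Definition partial_isometry_with_initial_space T (M : set ('I_d -> U)) :=
  (forall f, M f -> ip (row_op T f) (row_op T f) = \sum_i ip (f i) (f i)) /\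
  (forall f, (forall g, M g -> \sum_i ip (g i) (f i) = 0) -> row_op T f = 0).

End Tuples.

Section Ball.
Variable d : nat.
Implicit Types z w : 'rV[R[i]]_d.

Definition dotC z w : R[i] := \sum_i z 0 i * (w 0 i)^*.

Definition unit_ball : set 'rV[R[i]]_d := [set z | dotC z z < 1].

End Ball.

(* A reproducing kernel Hilbert space of V-valued functions on the ball: its
   elements f are identified with the functions z |-> rk_eval z f. *)
Record rkhs (d : nat) (V : hilbertType R)
    (K : 'rV[R[i]]_d -> 'rV[R[i]]_d -> V -> V) := Rkhs {
  rk_space :> hilbertType R;
  rk_eval : 'rV[R[i]]_d -> rk_space -> V;
  rk_bounded : forall z, unit_ball z -> bop (rk_eval z);
  rk_inj : forall f g,
    (forall z, unit_ball z -> rk_eval z f = rk_eval z g) -> f = g;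
  rk_kernel : forall z w, unit_ball z -> unit_ball w ->
    adj (adj (rk_eval z)) \o adj (rk_eval w) = K z w }.

Arguments rk_eval {d V K} M z f : rename.

Definition rk_fun d V K (M : @rkhs d V K) (w : 'rV[R[i]]_d) : V -> M :=
  adj (rk_eval M w).

(* The full Fock space over C^d, given by an orthonormal basis indexed by
   words; fock_e alpha is e_(i_1) \otimes .. \otimes e_(i_k). *)
Record fock (d : nat) := Fock {
  fock_space :> hilbertType R;
  fock_e : seq 'I_d -> fock_space;
  fock_ortho : forall a c, ip (fock_e a) (fock_e c) = (a == c)%:R;
  fock_total : closed_span (range fock_e) = setT;
  fock_L : 'I_d -> fock_space -> fock_space;
  fock_L_bounded : forall i, bop (fock_L i);
  fock_LE : forall i a, fock_L i (fock_e a) = fock_e (i :: a) }.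

Arguments fock_L {d} F i x : rename.

Section Herglotz.
Variables (d : nat) (H : hilbertType R).
Implicit Types b : 'rV[R[i]]_d -> H -> H.

Definition DA_kernel (z w : 'rV[R[i]]_d) : H -> H := (1 - dotC z w)^-1 *: id.

(* b belongs to the closed unit ball of the multiplier algebra of the space
   with kernel DA_kernel. *)
Definition in_multiplier_ball b :=
  (forall z, unit_ball z -> bop (b z)) /\
  exists M : rkhs DA_kernel, forall f : M, exists2 g : M,
    (forall z, unit_ball z -> rk_eval M z g = b z (rk_eval M z f))
    & `|g| <= `|f|.

Definition purely_contractive b := forall z, unit_ball z ->
  exists2 r : R, r < 1 & forall h, `|b z h| <= r%:C * `|h|.

Definition herglotz_fun b z : H -> H := opinv (id - b z) \o (id + b z).

Definition herglotz_kernel b z w : H -> H :=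
  (2^-1 / (1 - dotC z w)) *: (herglotz_fun b z + adj (herglotz_fun b w)).

Variable b : 'rV[R[i]]_d -> H -> H.
Variable Lb : rkhs (herglotz_kernel b).

Definition herglotz_initial_space : set ('I_d -> Lb) :=
  closure (lspan [set f : 'I_d -> Lb | exists w h, unit_ball w /\
                    f = fun j => (w 0 j)^* *: rk_fun Lb w h]
           : set {ptws 'I_d -> Lb}).

Definition is_herglotz_row (V : 'I_d -> Lb -> Lb) :=
  [/\ forall j, bop (V j),
      partial_isometry_with_initial_space V herglotz_initial_space
    & forall w h, unit_ball w ->
        row_op V (fun j => (w 0 j)^* *: rk_fun Lb w h) =
        rk_fun Lb w h - rk_fun Lb 0 h].

Variable F : fock d.
Local Notation L := (fock_L F).

Definition fock_A : set (F -> F) := generated_algebra (range L).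

Definition fock_S : set (F -> F) :=
  opclosure (lspan [set opinv (id - op_conj L z) | z in @unit_ball d]).

Definition is_mu (mu : (F -> F) -> H -> H) :=
  completely_positive (opsys fock_S) mu /\
  forall z w, unit_ball z -> unit_ball w ->
    mu (opinv (id - conj_op L z) \o opinv (id - op_conj L w)) =
    herglotz_kernel b z w.

Definition is_nu (V : 'I_d -> Lb -> Lb) (nu : (F -> F) -> H -> H) :=
  completely_positive (opsys fock_A) nu /\
  forall alpha, nu (opword L alpha) =
    adj (rk_fun Lb 0) \o opword V alpha \o rk_fun Lb 0.

End Herglotz.

Section Extensions.
Variables (d : nat) (H : hilbertType R) (F : fock d).
Local Notation L := (fock_L F).

(* The completion Q^2(phi) of the algebraic tensor product of fock_A and H
   modulo null vectors, with the class [q2_tens a h] of a \otimes h and the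
   representation [q2_pi]; both are only constrained on fock_A. *)
Record Q2 (phi : (F -> F) -> H -> H) := MkQ2 {
  q2_space :> hilbertType R;
  q2_tens : (F -> F) -> H -> q2_space;
  q2_tens_linearl : forall (c : R[i]) x y h, fock_A x -> fock_A y ->
    q2_tens (c *: x + y) h = c *: q2_tens x h + q2_tens y h;
  q2_tens_linearr : forall x, fock_A x -> linear (q2_tens x);
  q2_ip : forall x y h g, fock_A x -> fock_A y ->
    ip (q2_tens x h) (q2_tens y g) = ip h (phi (adj x \o y) g);
  q2_dense : closed_span [set q2_tens x h | x in @fock_A d F & h in setT] = setT;
  q2_pi : (F -> F) -> q2_space -> q2_space;
  q2_pi_bounded : forall x, fock_A x -> bop (q2_pi x);
  q2_piE : forall x y h, fock_A x -> fock_A y ->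
    q2_pi x (q2_tens y h) = q2_tens (x \o y) h }.

Arguments q2_tens {phi} Q x h : rename.
Arguments q2_pi {phi} Q x y : rename.

Section Tight.
Variables (phi : (F -> F) -> H -> H) (Q : Q2 phi).

Definition P20 : set Q := closed_span
  [set x | exists n h, (exists j, n j != 0%N) /\ x = q2_tens Q (opsym L n) h].

Definition Q20 : set Q := closed_span
  [set x | exists alpha h, alpha != [::] /\ x = q2_tens Q (opword L alpha) h].

Definition q2_L (j : 'I_d) : Q -> Q := q2_pi Q (L j).

Definition P0 : Q -> Q := orthproj P20.

(* Operators on the subspaces Q20 and P20 are represented by functions on Q
   restricted to these sets. *)
Definition tight_T (j : 'I_d) : Q -> Q := q2_L j \_ Q20.
Definition tight_S (j : 'I_d) : Q -> Q := (P0 \o q2_L j) \_ P20.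

Definition tight := forall alpha x, P20 x ->
  opword tight_S alpha x = P0 (opword tight_T alpha x).

Definition tight_extension (mu : (F -> F) -> H -> H) :=
  [/\ completely_positive (opsys (@fock_A d F)) phi,
      forall a, opsys (@fock_S d F) a -> phi a = mu a
    & tight].

End Tight.
End Extensions.
End Operators.

Arguments q2_L {R d H F phi} Q j x.
Arguments P0 {R d H F phi} Q x.

(* Main.v *)
Require Import Defs.
From mathcomp Require Import all_boot all_order all_algebra.
From mathcomp Require Import sesquilinear complex.
From mathcomp Require Import all_classical all_reals all_analysis.
From mathcomp Require Import ring lra.

(** Write L for the creation operators, K_w for the kernel vectors of the
    Herglotz space, and k_w h for the class of (I - L w^* )^{-1} tensor h in
    Q^2(b), so that 1 tensor h = k_0 h.  Write R_j for the isometries of Q^2(b)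
    induced by the L_j.

    The point is that the Herglotz space sits inside Q^2(b) as a subspace that
    is co-invariant for R, and that V is the compression of R to it.  Both
    families of vectors solve a fixed-point equation,
      K_w h = K_0 h + V (w^* K_w h),   k_w h = 1 tensor h + R (w^* k_w h),
    and V, R are isometric on the vectors that occur.  Expanding an inner
    product of two solutions by means of these equations expresses it through
    inner products with K_0 h and with 1 tensor h alone ([kernel_equation]).
    These agree because nu takes the value K_0^* V^alpha K_0 at L^alpha: a
    Neumann series, with a remainder that tends to zero, passes from words to
    resolvents ([neumann_ip_eq]).  Hence K_w h |-> k_w h preserves inner
    products and extends to an isometry Gamma ([isometric_extension]).

    Its adjoint X satisfies X (L^alpha tensor h) = V^alpha K_0 h; this is an
    induction on alpha that uses V^* V (w^* K_w h) = w^* K_w h.  So X R_j = V_j X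
    on the closed span of the words L^alpha tensor h, and X Gamma = 1.

    It remains to see P^2_0(b) inside the range of Gamma.  It lies in that range
    because a vector orthogonal to all k_w h annihilates a power series in w,
    hence its homogeneous parts ([neumann_coef_eq0]) and then each of their
    coefficients L^n tensor h ([word_coef_eq0]).  It contains Gamma V_j y for
    every y, since a vector orthogonal to all (K_w - K_0) h is killed by every
    V_j^* ([adj_eq0_of_orth]) and k_w h - k_0 h belongs to P^2_0(b).
    Consequently P_0 q = Gamma X q as soon as Gamma X q lies in P^2_0(b), and
      P_0 R^alpha Gamma y = Gamma V^alpha y,
    for every nonempty word alpha.  Semi-invariance and tightness both follow by
    comparing the two sides of this formula.

    That nu extends mu is seen on the resolvents first, where both maps take the
    value K_0^* K_w.  A completely positive map is bounded and respects adjoints: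
    both facts come out of its value on the positive 2 by 2 matrix with r on the
    diagonal and a, a^* off it ([cp_pair]).  So the equality passes to norm
    closures and adjoints ([cp_agree]). *)

Set Implicit Arguments.
Unset Strict Implicit.
Unset Printing Implicit Defensive.
Import Order.TTheory GRing.Theory Num.Theory numFieldNormedType.Exports.
Local Open Scope classical_set_scope.
Local Open Scope complex_scope.
Local Open Scope ring_scope.

(** * Inner products and real-valued norms *)

Section InnerProduct.
Variables (R : realType) (U : hilbertType R).
Implicit Types (x y z : U) (c : R[i]).

Lemma ipDr x y z : ip x (y + z) = ip x y + ip x z.
Proof. exact: linearDl. Qed.

Lemma ipDl x y z : ip (x + y) z = ip x z + ip y z.
Proof. exact: linearDr. Qed.

Lemma ipZr c x y : ip x (c *: y) = c * ip x y.
Proof. exact: linearZl_LR. Qed.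

Lemma ipZl c x y : ip (c *: x) y = c^* * ip x y.
Proof. exact: linearZr_LR. Qed.

Lemma ip_conj x y : ip x y = (ip y x)^*.
Proof. by rewrite /ip hermC expr0 mul1r. Qed.

Lemma ip0l x : ip 0 x = 0.
Proof. by rewrite -(scale0r 0) ipZl rmorph0 mul0r. Qed.
Lemma ip0r x : ip x 0 = 0.
Proof. by rewrite -(scale0r 0) ipZr mul0r. Qed.
Lemma ipNl x y : ip (- x) y = - ip x y.
Proof. by rewrite -scaleN1r ipZl rmorphN1 mulN1r. Qed.
Lemma ipNr x y : ip x (- y) = - ip x y.
Proof. by rewrite -scaleN1r ipZr mulN1r. Qed.
Lemma ipBl x y z : ip (x - y) z = ip x z - ip y z.
Proof. by rewrite ipDl ipNl. Qed.
Lemma ipBr x y z : ip x (y - z) = ip x y - ip x z.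
Proof. by rewrite ipDr ipNr. Qed.

Lemma ip_suml I (r : seq I) (P : pred I) (f : I -> U) y :
  ip (\sum_(i <- r | P i) f i) y = \sum_(i <- r | P i) ip (f i) y.
Proof.
by elim/big_rec2: _ => [|i a b _ <-]; rewrite ?ip0l ?ipDl.
Qed.

Lemma ip_sumr I (r : seq I) (P : pred I) (f : I -> U) y :
  ip y (\sum_(i <- r | P i) f i) = \sum_(i <- r | P i) ip y (f i).
Proof.
by elim/big_rec2: _ => [|i a b _ <-]; rewrite ?ip0r ?ipDr.
Qed.

End InnerProduct.

Section RealNorm.
Variable R : realType.

Lemma conjR (r : R) : (r%:C)^* = r%:C.
Proof. exact: conjc_real. Qed.

(** The norm of a complex normed space has its values in R[i].  Its real part
    carries the same information and lives in an ordered field, where order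
    arguments apply. *)
Definition nm (V : normedModType R[i]) (x : V) : R := complex.Re `|x|.

Section NormedModule.
Variable V : normedModType R[i].
Implicit Types x y z : V.

Lemma nmE x : `|x| = (nm x)%:C.
Proof. by rewrite /nm RRe_real // ger0_real. Qed.
Lemma nm_ge0 x : 0 <= nm x.
Proof. by rewrite -ler0c -nmE. Qed.
Lemma nm0 : nm (0 : V) = 0.
Proof. by rewrite /nm normr0. Qed.
Lemma nm_eq0 x : nm x = 0 -> x = 0.
Proof. by move=> e; apply/eqP; rewrite -normr_eq0 nmE e. Qed.
Lemma nmD x y : nm (x + y) <= nm x + nm y.
Proof. by rewrite -lecR rmorphD /= -!nmE; apply: ler_normD. Qed.
Lemma nmN x : nm (- x) = nm x.
Proof. by rewrite /nm normrN. Qed.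
Lemma nmBC x y : nm (x - y) = nm (y - x).
Proof. by rewrite -nmN opprB. Qed.
Lemma nmZ (c : R[i]) x : nm (c *: x) = nm (c : R[i]^o) * nm x.
Proof. by apply: complexI; rewrite rmorphM /= -!nmE normrZ. Qed.
Lemma nmB_tri y x z : nm (x - z) <= nm (x - y) + nm (y - z).
Proof. by rewrite (le_trans _ (nmD _ _)) // addrA subrK. Qed.
Lemma nm_sum I (r : seq I) (P : pred I) (f : I -> V) :
  nm (\sum_(i <- r | P i) f i) <= \sum_(i <- r | P i) nm (f i).
Proof.
elim/big_rec2: _ => [|i a b _ le]; first by rewrite nm0.
by rewrite (le_trans (nmD _ _)) ?lerD2l.
Qed.
End NormedModule.

(** The modulus of a complex number is [nm] on the regular module. *)
Definition cm (c : R[i]) : R := nm (c : R[i]^o).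
Lemma cmE c : `|c| = (cm c)%:C. Proof. exact: (@nmE R[i]^o). Qed.
Lemma cm_ge0 c : 0 <= cm c. Proof. exact: nm_ge0. Qed.
Lemma cmD c d : cm (c + d) <= cm c + cm d. Proof. exact: (@nmD R[i]^o). Qed.
Lemma cmN c : cm (- c) = cm c. Proof. exact: (@nmN R[i]^o). Qed.
Lemma cmM c d : cm (c * d) = cm c * cm d. Proof. exact: (@nmZ R[i]^o). Qed.
Lemma cm_eq0 c : cm c = 0 -> c = 0. Proof. exact: (@nm_eq0 R[i]^o). Qed.
Lemma cm0 : cm 0 = 0. Proof. exact: (@nm0 R[i]^o). Qed.
Lemma cmR (r : R) : cm r%:C = `|r|.
Proof. by rewrite /cm/nm normc_def /= expr0n addr0 sqrtr_sqr. Qed.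
Lemma cmJ c : cm c^* = cm c.
Proof. by rewrite /cm/nm norm_conjC. Qed.
Lemma mulCJ c : c * c^* = (cm c ^+ 2)%:C.
Proof. by rewrite -normCK cmE rmorphXn. Qed.
Lemma cm_Re c : complex.Re c <= cm c.
Proof.
by rewrite (le_trans (ler_norm _)) // -lecR -cmE normc_ge_Re.
Qed.

Lemma nmZc (V : normedModType R[i]) c (x : V) : nm (c *: x) = cm c * nm x.
Proof. exact: nmZ. Qed.

(** Most limit arguments below end here: they bound a nonnegative quantity by
    every positive multiple of a fixed constant. *)
Lemma le_eps (a b : R) : 0 <= b -> (forall e : R, 0 < e -> a <= e * b) -> a <= 0.
Proof.
move=> b0 h; rewrite leNgt; apply/negP => a0.
have b1 : 0 < b + 1 by rewrite ltr_wpDl.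
have /h : 0 < a / (b + 1) by rewrite divr_gt0.
rewrite mulrAC ler_pdivlMr //; nra.
Qed.

Lemma natSinv_small (e : R) : 0 < e ->
  exists N, forall n, (N <= n)%N -> n.+1%:R^-1 < e.
Proof.
move=> e0; have [N _ hN] := near_infty_natSinv_lt (PosNum e0).
by exists N.
Qed.

End RealNorm.
Arguments cm {R} c.

Section CauchySchwarz.
Variables (R : realType) (U : hilbertType R).
Implicit Types (x y z : U) (c : R[i]).

Lemma ipxx x : ip x x = (nm x ^+ 2)%:C.
Proof. by rewrite /ip -normsq_inner nmE rmorphXn. Qed.

Lemma ipxx_eq0 x : ip x x = 0 -> x = 0.
Proof.
rewrite ipxx => /complexI /eqP; rewrite sqrf_eq0 => /eqP; exact: nm_eq0.
Qed.

Lemma ip_ge0 x : 0 <= ip x x.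
Proof. by rewrite ipxx ler0c sqr_ge0. Qed.

Lemma nm_sq x : nm x ^+ 2 = complex.Re (ip x x).
Proof. by rewrite ipxx. Qed.

Lemma ReJ c : complex.Re c^* = complex.Re c.
Proof. by case: c. Qed.

Lemma nmD_sq x y :
  nm (x + y) ^+ 2 = nm x ^+ 2 + nm y ^+ 2 + 2 * complex.Re (ip x y).
Proof.
rewrite !nm_sq !ipDl !ipDr !raddfD /= [ip y x]ip_conj ReJ.
ring.
Qed.

Lemma nmB_sq x y :
  nm (x - y) ^+ 2 = nm x ^+ 2 + nm y ^+ 2 - 2 * complex.Re (ip x y).
Proof. by rewrite nmD_sq nmN ipNr raddfN /= mulrN. Qed.

(** Expand the square norm of |x|^2 y - <x,y> x, which is nonnegative, and
    divide by |x|^2. *)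
Lemma cauchy_schwarz x y : cm (ip x y) <= nm x * nm y.
Proof.
have [->|x0] := eqVneq x 0; first by rewrite ip0l cm0 nm0 mul0r.
have nx : 0 < nm x.
  by rewrite lt_def nm_ge0 andbT; apply: contraNneq x0 => /nm_eq0 ->.
set c := ip x y.
have := sqr_ge0 (nm ((nm x ^+ 2)%:C *: y - c *: x)).
rewrite nmB_sq !nmZc ipZl ipZr [ip y x]ip_conj -/c cmR conjR.
have -> : (nm x ^+ 2)%:C * (c * c^*) = (nm x ^+ 2 * cm c ^+ 2)%:C.
  by rewrite mulCJ -rmorphM.
rewrite ger0_norm ?sqr_ge0 //= => h.
have := nm_ge0 y; have := cm_ge0 c; move: h nx.
move: (cm c) (nm x) (nm y) => a p q h p0 a0 q0.
rewrite -(@ler_pXn2r _ 2) ?nnegrE ?mulr_ge0 ?(ltW p0) //.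
rewrite -(ler_pM2l (exprn_gt0 2 p0)); nra.
Qed.

Lemma Re_ip_le x y : complex.Re (ip x y) <= nm x * nm y.
Proof. exact: le_trans (cm_Re _) (cauchy_schwarz _ _). Qed.

Lemma ip_inj x y : (forall z, ip z x = ip z y) -> x = y.
Proof.
move=> h; apply/eqP; rewrite -subr_eq0; apply/eqP/ipxx_eq0.
by rewrite ipBr h subrr.
Qed.

Lemma parallelogram x y :
  nm (x + y) ^+ 2 + nm (x - y) ^+ 2 = 2 * nm x ^+ 2 + 2 * nm y ^+ 2.
Proof. rewrite nmD_sq nmB_sq; ring. Qed.

End CauchySchwarz.

Lemma nm_eq_ip (R : realType) (U V : hilbertType R) (x : U) (y : V) :
  ip x x = ip y y -> nm x = nm y.
Proof.
move=> e; apply/eqP; rewrite -(@eqrXn2 _ 2) ?nm_ge0 //.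
by rewrite !nm_sq e.
Qed.


Section Metric.
Variable R : realType.
Implicit Types U V : completeNormedModType R[i].

(** This lemma and the next two turn closures, completeness and continuity
    into estimates on [nm]. *)
Lemma closure_nmP U (A : set U) x :
  closure A x <-> forall e : R, 0 < e -> exists2 y, A y & nm (x - y) < e.
Proof.
split=> [cl e e0|h B /nbhs_ballP[e /= e0 eB]].
  have := cl (ball x e%:C).
  case; first by apply: nbhsx_ballx; rewrite ltcR.
  move=> y []; rewrite -ball_normE /= nmE ltcR => Ay xy.
  by exists y.
have eE : e = (complex.Re e)%:C by rewrite RRe_real // gtr0_real.
have [|y Ay xy] := h (complex.Re e); first by rewrite -ltcR -eE.
exists y; split=> //; apply: eB.
by rewrite -ball_normE /= nmE eE ltcR.
Qed.

Lemma complete_nm U (u : nat -> U) :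
  (forall e : R, 0 < e -> exists N, forall m n, (N <= m)%N -> (N <= n)%N ->
     nm (u m - u n) < e) ->
  exists l, forall e : R, 0 < e -> exists N, forall n, (N <= n)%N ->
     nm (u n - l) < e.
Proof.
move=> h; have : cvg (u @ \oo).
  apply/cauchy_cvgP/cauchy_ballP => e e0.
  have eE : e = (complex.Re e)%:C by rewrite RRe_real // gtr0_real.
  have [|N uN] := h (complex.Re e); first by rewrite -ltcR -eE.
  rewrite near_map2; exists ([set n | N <= n]%N, [set n | N <= n]%N) => /=.
    by split; exists N.
  move=> [m n] /= [mN nN].
  by rewrite -ball_normE /= nmE eE ltcR uN.
move=> /cvgrPdist_lt cu; exists (lim (u @ \oo)) => e e0.
have [|N _ uN] := cu e%:C; first by rewrite ltcR.
by exists N => n nN; have := uN _ nN; rewrite /= nmE ltcR nmBC.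
Qed.

Lemma continuous_nmP U V (f : U -> V) : linear f ->
  continuous f <-> exists2 C : R, 0 <= C & forall x, nm (f x) <= C * nm x.
Proof.
move=> lf; split=> [cf|[C C0 fC]].
  have /cvgrPdist_lt /(_ 1 ltr01) := cf 0.
  move=> /nbhs_ballP [e /= e0 he].
  have f0 : f 0 = 0.
    by have := lf (-1) 0 0; rewrite scaler0 addr0 scaleN1r addNr.
  have eE : e = (complex.Re e)%:C by rewrite RRe_real // gtr0_real.
  set r := complex.Re e in eE; have r0 : 0 < r by rewrite -ltcR -eE.
  exists (2 / r) => [|x]; first by rewrite divr_ge0 // ltW.
  have [->|x0] := eqVneq x 0; first by rewrite f0 !nm0 mulr0.
  have nx : 0 < nm x.
    by rewrite lt_def nm_ge0 andbT; apply: contraNneq x0 => /nm_eq0 ->.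
  pose c := r / (2 * nm x).
  have c0 : 0 < c by rewrite divr_gt0 ?mulr_gt0.
  have fZ : f (c%:C *: x) = c%:C *: f x.
    by have := lf c%:C x 0; rewrite !addr0 f0 addr0.
  have := he (c%:C *: x); rewrite /= -ball_normE /= f0 !sub0r !normrN fZ.
  rewrite !nmE eE !ltcR !nmZc cmR gtr0_norm //.
  have -> : c * nm x = r / 2.
    by rewrite /c; field; rewrite gt_eqF.
  move=> h; have {h}/ltW h : c * nm (f x) < 1 by apply: h; lra.
  rewrite -(ler_pM2l c0) (le_trans h) // le_eqVlt; apply/orP; left.
  by apply/eqP; rewrite /c; field; rewrite !gt_eqF.
move=> x; apply/cvgrPdist_lt => e e0.
have eE : e = (complex.Re e)%:C by rewrite RRe_real // gtr0_real.
set r := complex.Re e in eE; have r0 : 0 < r by rewrite -ltcR -eE.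
have C1 : 0 < C + 1 by rewrite ltr_wpDl.
apply/nbhs_ballP; exists (r / (C + 1))%:C => /=.
  by rewrite ltcR divr_gt0.
move=> y; rewrite -ball_normE /= !nmE eE !ltcR ltr_pdivlMr // => h.
have -> : f x - f y = f (x - y).
  by have := lf (-1) y x; rewrite !scaleN1r ![- _ + _]addrC => ->.
apply: le_lt_trans (fC _) _; apply: le_lt_trans h.
rewrite mulrC ler_wpM2l ?nm_ge0 //; lra.
Qed.

End Metric.

(** * Closed subspaces, projections and adjoints *)

Section Subspaces.
Variable R : realType.

Section LinearSpan.
Variable E : lmodType R[i].
Implicit Types (X M : set E) (x y : E).

Definition subspace M := M 0 /\ forall (c : R[i]) x y, M x -> M y -> M (c *: x + y).

Lemma lspan_sub X : X `<=` lspan X.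
Proof.
by move=> x Xx; exists 1%N, (fun=> 1), (fun=> x); rewrite big_ord1 scale1r.
Qed.

Lemma lspan_subspace X : subspace (lspan X).
Proof.
split=> [|c _ _ [n [a [u [Xu ->]]]] [m [b [v [Xv ->]]]]].
  by exists 0%N, (fun=> 0), (fun=> 0); rewrite big_ord0; split=> // [[]].
exists (n + m)%N,
  (fun i : 'I_(n + m) =>
     match fintype.split i with inl j => c * a j | inr j => b j end),
  (fun i : 'I_(n + m) =>
     match fintype.split i with inl j => u j | inr j => v j end).
split=> [i|]; first by case: fintype.split.
rewrite big_split_ord /= scaler_sumr; congr (_ + _).
  by apply: eq_bigr => i _; rewrite (unsplitK (inl i)) scalerA.
by apply: eq_bigr => i _; rewrite (unsplitK (inr i)).
Qed.

Lemma subspace_sum M (I : Type) (r : seq I) (P : pred I) (f : I -> E) :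
  subspace M -> (forall i, P i -> M (f i)) -> M (\sum_(i <- r | P i) f i).
Proof.
move=> [M0 Ml] Mf; elim/big_ind: _ => // x y Mx My.
by rewrite -[x]scale1r; exact: Ml.
Qed.

Lemma subspaceZ M (c : R[i]) x : subspace M -> M x -> M (c *: x).
Proof. by move=> [M0 Ml] Mx; rewrite -[c *: x]addr0; exact: Ml. Qed.

Lemma subspaceD M x y : subspace M -> M x -> M y -> M (x + y).
Proof. by move=> [M0 Ml] Mx My; rewrite -[x]scale1r; exact: Ml. Qed.

Lemma subspaceB M x y : subspace M -> M x -> M y -> M (x - y).
Proof. by move=> [M0 Ml] Mx My; rewrite addrC -scaleN1r; exact: Ml. Qed.

Lemma lspan_min X M : subspace M -> X `<=` M -> lspan X `<=` M.
Proof.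
move=> sM XM _ [n [c [v [Xv ->]]]].
by apply: subspace_sum => // i _; apply: subspaceZ => //; exact/XM/Xv.
Qed.

End LinearSpan.

Variable U : hilbertType R.
Implicit Types (X M : set U) (x y : U).

Definition closed_subspace M := subspace M /\ closure M `<=` M.

Lemma closed_span_closed_subspace X : closed_subspace (closed_span X).
Proof.
have sX := lspan_subspace X.
split; last first.
  move=> x /closure_nmP cx; apply/closure_nmP => e e0.
  have e2 : 0 < e / 2 by rewrite divr_gt0.
  have [y /closure_nmP cy xy] := cx _ e2; have [z Xz yz] := cy _ e2.
  by exists z => //; have := nmB_tri y x z; lra.
split=> [|c x y /closure_nmP cx /closure_nmP cy].
  by apply/closure_nmP => e e0; exists 0; rewrite ?subrr ?nm0 //; case: sX.
apply/closure_nmP => e e0.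
have c1 : 0 < cm c + 1 by rewrite ltr_wpDl ?cm_ge0.
have e2 : 0 < e / 2 by rewrite divr_gt0.
have e3 : 0 < e / 2 / (cm c + 1) by rewrite divr_gt0.
have [x' Xx' xx'] := cx _ e3; have [y' Xy' yy'] := cy _ e2.
exists (c *: x' + y'); first by apply: sX.2.
rewrite opprD addrACA -scalerBr.
apply: le_lt_trans (nmD _ _) _; rewrite nmZc.
have : cm c * nm (x - x') <= e / 2.
  move: xx'; rewrite ltr_pdivlMr // => /ltW; apply: le_trans.
  by rewrite mulrC ler_wpM2l ?nm_ge0 // lerDl.
lra.
Qed.

Lemma closed_span_sub X : X `<=` closed_span X.
Proof. by move=> x Xx; exact/subset_closure/lspan_sub. Qed.

Lemma closed_span_min X M :
  closed_subspace M -> X `<=` M -> closed_span X `<=` M.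
Proof.
move=> [sM cM] XM x cx; apply: cM; apply: closure_subset cx.
exact: lspan_min.
Qed.

Lemma orthogonal_closed_subspace y : closed_subspace [set x | ip y x = 0].
Proof.
split; [split=> [|c a b /=]|move=> x /closure_nmP h /=].
- exact: ip0r.
- by rewrite ipDr ipZr => -> ->; rewrite mulr0 addr0.
apply: cm_eq0; apply/eqP; rewrite eq_le cm_ge0 andbT.
apply: (le_eps (nm_ge0 y)) => e e0.
have [z /= z0 xz] := h e e0.
rewrite -[ip y x]subr0 -z0 -ipBr (le_trans (cauchy_schwarz _ _)) //.
by rewrite mulrC ler_wpM2r ?nm_ge0 // ltW.
Qed.

Lemma orthogonal_closed_span X y :
  (forall x, X x -> ip y x = 0) -> forall x, closed_span X x -> ip y x = 0.
Proof.
by move=> h; apply: closed_span_min => //; exact: orthogonal_closed_subspace.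
Qed.

Lemma ip_eq0_sym x y : ip x y = 0 -> ip y x = 0.
Proof. by move=> e; rewrite ip_conj e rmorph0. Qed.

(** A sequence in M whose distances to x tend to their infimum is Cauchy by
    the parallelogram identity.  Its limit is a nearest point, and moving it
    along m in M shows that x minus it is orthogonal to m. *)
Lemma projection_theorem M : closed_subspace M ->
  forall x, exists y, M y /\ forall m, M m -> ip m (x - y) = 0.
Proof.
move=> [sM cM] x; have [M0 Ml] := sM.
pose D : set R := [set nm (x - m) | m in M].
have D0 : has_inf D.
  split; first by exists (nm (x - 0)), 0.
  by exists 0 => _ [m _ <-]; exact: nm_ge0.
set d := inf D.
have dle m : M m -> d <= nm (x - m).
  by move=> Mm; apply: (ge_inf D0.2); exists m.
have d0 : 0 <= d by apply: lb_le_inf D0.1 _ => _ [m _ <-]; exact: nm_ge0.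
have [u uP] : exists u : nat -> U, forall n,
    M (u n) /\ nm (x - u n) < d + n.+1%:R^-1.
  suff /choice[] : forall n, exists v, M v /\ nm (x - v) < d + n.+1%:R^-1.
    by move=> u uP; exists u.
  move=> n; have n0 : 0 < n.+1%:R^-1 :> R by rewrite invr_gt0.
  have [_ [m Mm <-] h] := inf_adherent n0 D0.
  by exists m.
have cau (e : R) : 0 < e -> exists N, forall m n, (N <= m)%N -> (N <= n)%N ->
    nm (u m - u n) < e.
  (* With distances below d + t, the parallelogram identity bounds the square
     of the difference by 4 (t^2 + 2 d t), and t^2 <= t. *)
  move=> e0; pose t := Num.min 1 (e ^+ 2 / (8 * (d + 1))).
  have d1 : 0 < 8 * (d + 1) by rewrite mulr_gt0 // ltr_wpDl.
  have t0 : 0 < t by rewrite lt_min ltr01 divr_gt0 ?exprn_gt0.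
  have t1 : t <= 1 by rewrite ge_min lexx.
  have t2 : t * (8 * (d + 1)) <= e ^+ 2.
    by rewrite -ler_pdivlMr // ge_min lexx orbT.
  have [N hN] := natSinv_small t0; exists N => m n mN nN.
  have [Mm um] := uP m; have [Mn un] := uP n.
  have := hN _ mN; have := hN _ nN.
  have mid : d <= nm (x - 2^-1 *: (u m + u n)).
    by apply/dle/(subspaceZ _ sM)/(subspaceD sM).
  have E1 : nm (x - u n + (x - u m)) = 2 * nm (x - 2^-1 *: (u m + u n)).
    have -> : x - u n + (x - u m) = (2 : R)%:C *: (x - 2^-1 *: (u m + u n)).
      rewrite scalerBr scalerA rmorph_nat mulfV ?pnatr_eq0 // scale1r.
      by rewrite scaler_nat mulr2n addrACA opprD [- u n - _]addrC.
    by rewrite nmZc cmR ger0_norm.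
  have E2 : nm (x - u n - (x - u m)) = nm (u m - u n).
    by congr nm; rewrite opprB addrC addrA addrNK.
  have := parallelogram (x - u n) (x - u m); rewrite E1 E2.
  move: um un mid (nm_ge0 (x - u m)) (nm_ge0 (x - u n)) (nm_ge0 (u m - u n)).
  move: (nm (x - u m)) (nm (x - u n)) (nm (u m - u n)).
  move: (nm (x - 2^-1 *: (u m + u n))) m.+1%:R^-1 n.+1%:R^-1.
  move=> s i j p q r pi qj ds p0 q0 r0 E jt it.
  rewrite -(@ltr_pXn2r _ 2) ?nnegrE ?(ltW e0) //.
  have p2 : p ^+ 2 <= (d + t) ^+ 2 by rewrite ler_pXn2r ?nnegrE //; lra.
  have q2 : q ^+ 2 <= (d + t) ^+ 2 by rewrite ler_pXn2r ?nnegrE //; lra.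
  have s2 : d ^+ 2 <= s ^+ 2 by rewrite ler_pXn2r ?nnegrE //; lra.
  have tt : t * t <= t by rewrite ler_piMl // ltW.
  lra.
have [y uy] := complete_nm cau.
have My : M y.
  apply/cM/closure_nmP => e e0; have [N hN] := uy _ e0.
  by exists (u N); [case: (uP N)|rewrite nmBC hN].
have yd : nm (x - y) <= d.
  rewrite -subr_le0; apply: (@le_eps _ _ 2) => // e e0.
  have [N hN] := uy _ e0; have [N' hN'] := natSinv_small e0.
  have := hN _ (leq_maxl N N'); have := hN' _ (leq_maxr N N').
  have [_] := uP (maxn N N'); have := nmB_tri (u (maxn N N')) x y.
  move: (_.+1%:R^-1) (nm (x - u _)) (nm (u _ - y)) => p q r; lra.
exists y; split=> // m Mm; set c := ip m (x - y).
apply: cm_eq0; apply/eqP; rewrite -sqrf_eq0 eq_le sqr_ge0 andbT.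
apply: (@le_eps _ _ (cm c ^+ 2 * nm m ^+ 2)); first by rewrite mulr_ge0 ?sqr_ge0.
(* Comparing the nearest point with its translate by e <m, x - y> m leaves,
   after division by e, a bound on |<m, x - y>|^2 of order e. *)
move=> e e0; have : nm (x - y) <= nm (x - y - (e%:C * c) *: m).
  by rewrite (le_trans yd) // -addrA -opprD dle // addrC; exact: Ml.
rewrite -(@ler_pXn2r _ 2) ?nnegrE ?nm_ge0 // [nm (_ - _ *: _) ^+ 2]nmB_sq ipZr nmZc.
rewrite [ip (x - y) m]ip_conj -/c -mulrA mulCJ -rmorphM cmM cmR gtr0_norm //=.
set a := cm c ^+ 2 => h.
have {}h : e * (2 * a) <= e * (e * (a * nm m ^+ 2)) by rewrite /a in h *; nra.
rewrite ler_pM2l // in h; have : 0 <= a by rewrite sqr_ge0.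
lra.
Qed.

Lemma orthproj_eq M x y :
  M y -> (forall m, M m -> ip m (x - y) = 0) -> orthproj M x = y.
Proof.
move=> My yP; rewrite /orthproj; case: xgetP => [z _ [Mz zP]|/(_ y)]; last by case.
apply/eqP; rewrite -subr_eq0; apply/eqP/ipxx_eq0.
rewrite ipBl.
have -> : z - y = (x - y) - (x - z) by rewrite opprB [RHS]addrC addrA addrNK.
by rewrite ![ip _ (_ - (x - z))]ipBr !yP // !zP // !subrr.
Qed.

Lemma orthprojP M x : closed_subspace M ->
  M (orthproj M x) /\ forall m, M m -> ip m (x - orthproj M x) = 0.
Proof.
move=> cM; have [y [My yP]] := projection_theorem cM x.
by rewrite (orthproj_eq My yP).
Qed.

(** The difference of x and its projection is orthogonal to M, hence to x, and
    so it vanishes. *)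
Lemma biorthogonal M x : closed_subspace M ->
  (forall y, (forall m, M m -> ip m y = 0) -> ip x y = 0) -> M x.
Proof.
move=> cM h; have [Mp xp] := orthprojP x cM.
suff -> : x = orthproj M x by [].
apply/eqP; rewrite -subr_eq0; apply/eqP/ipxx_eq0.
by rewrite ipBl h // xp // subr0.
Qed.

(** The orthogonal complement of the kernel is spanned by the component z of
    any vector outside the kernel; f and the product with z agree on z up to a
    scalar. *)
Lemma riesz (f : U -> R[i]) (C : R) :
  (forall (c : R[i]) x y, f (c *: x + y) = c * f x + f y) ->
  0 <= C -> (forall x, cm (f x) <= C * nm x) -> exists y, forall x, f x = ip y x.
Proof.
move=> lf C0 fC.
have f0 : f 0 = 0.
  by have := lf (-1) 0 0; rewrite scaler0 addr0 mulN1r addNr.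
have fB x y : f (x - y) = f x - f y.
  by rewrite addrC -scaleN1r lf mulN1r addrC.
have cM : closed_subspace [set x | f x = 0].
  split; [split=> // c x y /= fx fy; first by rewrite lf fx fy mulr0 addr0|].
  move=> x /closure_nmP h /=.
  apply: cm_eq0; apply/eqP; rewrite eq_le cm_ge0 andbT.
  apply: (le_eps C0) => e e0; have [z /= z0 xz] := h e e0.
  rewrite -[f x]subr0 -z0 -fB (le_trans (fC _)) //.
  by rewrite mulrC ler_wpM2r // ltW.
have [allz|] := pselect (forall x, f x = 0).
  by exists 0 => x; rewrite ip0l allz.
move=> /existsNP[x0 fx0].
have [/= fp xp] := orthprojP x0 cM.
set z := x0 - _ in xp.
have fz : f z <> 0 by rewrite /z fB fp subr0.
have zz : ip z z != 0.
  by apply/eqP => /ipxx_eq0 z0; apply: fz; rewrite z0.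
exists ((f z / ip z z)^* *: z) => x.
rewrite ipZl conjCK.
have : ip (x - (f x / f z) *: z) z = 0.
  apply: xp => /=; rewrite fB -[_ *: _]addr0 lf f0 addr0 divfK ?subrr //.
  exact/eqP.
move=> /ip_eq0_sym; rewrite ipBr ipZr => /eqP; rewrite subr_eq0 => /eqP ->.
by field; rewrite zz andbT; apply/eqP.
Qed.

End Subspaces.

Section Adjoint.
Variable R : realType.
Implicit Types U V W : hilbertType R.

Lemma bopP U V (f : U -> V) : bop f <->
  linear f /\ exists2 C : R, 0 <= C & forall x, nm (f x) <= C * nm x.
Proof. by split=> -[lf cf]; split=> //; apply/continuous_nmP. Qed.

Lemma lin0 U V (f : U -> V) : linear f -> f 0 = 0.
Proof.
by move=> lf; have := lf (-1) 0 0; rewrite scaler0 addr0 scaleN1r addNr.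
Qed.

Lemma linD U V (f : U -> V) x y : linear f -> f (x + y) = f x + f y.
Proof. by move=> lf; rewrite -[x]scale1r lf !scale1r. Qed.

Lemma linZ U V (f : U -> V) (c : R[i]) x : linear f -> f (c *: x) = c *: f x.
Proof. by move=> lf; rewrite -[c *: x]addr0 lf lin0 // addr0. Qed.

Lemma linB U V (f : U -> V) x y : linear f -> f (x - y) = f x - f y.
Proof. by move=> lf; rewrite linD // -scaleN1r linZ // scaleN1r. Qed.

Lemma lin_sum U V (f : U -> V) I (r : seq I) (P : pred I) (g : I -> U) :
  linear f -> f (\sum_(i <- r | P i) g i) = \sum_(i <- r | P i) f (g i).
Proof.
move=> lf; elim/big_rec2: _ => [|i a b _ <-]; first exact: lin0.
by rewrite linD.
Qed.

(** [adj] picks an adjoint; since adjoints are unique, exhibiting one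
    identifies it. *)
Lemma adj_eq U V (f : U -> V) (g : V -> U) :
  (forall x y, ip (f x) y = ip x (g y)) -> adj f = g.
Proof.
move=> fg; rewrite /adj; case: xgetP => [h _ hP|/(_ g)]; last by case.
by apply/funext => y; apply: ip_inj => x; rewrite -hP fg.
Qed.

Lemma adjP U V (f : U -> V) x y : bop f -> ip (f x) y = ip x (adj f y).
Proof.
move=> /bopP[lf [C C0 fC]].
suff [g gP] : exists g : V -> U, forall x y, ip (f x) y = ip x (g y).
  by rewrite (adj_eq gP).
suff /choice[g gP] : forall v, exists u, forall x, ip (f x) v = ip x u.
  by exists g.
move=> v.
have [u uP] : exists u, forall x, ip v (f x) = ip u x.
  apply: (@riesz _ _ _ (nm v * C)) => [c a b||a].
  - by rewrite lf ipDr ipZr.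
  - by rewrite mulr_ge0 ?nm_ge0.
  - rewrite (le_trans (cauchy_schwarz _ _)) // -mulrA ler_wpM2l ?nm_ge0 //.
by exists u => a; rewrite ip_conj uP -ip_conj.
Qed.

Lemma adjPl U V (f : U -> V) x y : bop f -> ip (adj f y) x = ip y (f x).
Proof. by move=> bf; rewrite ip_conj -adjP // -ip_conj. Qed.

Lemma adj_linear U V (f : U -> V) : bop f -> linear (adj f).
Proof.
move=> bf c x y; apply: ip_inj => z.
by rewrite -adjP // !ipDr !ipZr -!adjP.
Qed.

Lemma nm_adj U V (f : U -> V) (C : R) y : bop f -> 0 <= C ->
  (forall x, nm (f x) <= C * nm x) -> nm (adj f y) <= C * nm y.
Proof.
move=> bf C0 fC.
have h : nm (adj f y) ^+ 2 <= C * nm (adj f y) * nm y.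
  rewrite nm_sq -adjP // (le_trans (Re_ip_le _ _)) //.
  by rewrite ler_wpM2r ?nm_ge0.
have := nm_ge0 (adj f y); rewrite le_eqVlt => /orP[/eqP <-|a0].
  by rewrite mulr_ge0 ?nm_ge0.
by rewrite -(ler_pM2l a0) -expr2 (le_trans h) // mulrCA mulrA.
Qed.

Lemma adj_bop U V (f : U -> V) : bop f -> bop (adj f).
Proof.
move=> bf; have /bopP[_ [C C0 fC]] := bf; apply/bopP.
by split; [exact: adj_linear|exists C => // y; exact: nm_adj].
Qed.

Lemma adjK U V (f : U -> V) : bop f -> adj (adj f) = f.
Proof. by move=> bf; apply: adj_eq => x y; rewrite adjPl. Qed.

Lemma adj_id U : adj (@id U) = id.
Proof. exact: adj_eq. Qed.

Lemma adj_linC U V (c : R[i]) (f g : U -> V) : bop f -> bop g ->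
  adj (c *: f + g) = c^* *: adj f + adj g.
Proof.
move=> bf bg; apply: adj_eq => x y.
by rewrite !fctE /= ipDl ipZl ipDr ipZr !adjP.
Qed.

Lemma bop_id U : bop (@id U).
Proof.
by apply/bopP; split=> //; exists 1 => // x; rewrite mul1r.
Qed.

Lemma bop_comp U V W (f : V -> W) (g : U -> V) : bop f -> bop g -> bop (f \o g).
Proof.
move=> /bopP[lf [C C0 fC]] /bopP[lg [D D0 gD]]; apply/bopP; split.
  by move=> c x y /=; rewrite lg lf.
exists (C * D) => [|x /=]; first exact: mulr_ge0.
by rewrite (le_trans (fC _)) // -mulrA ler_wpM2l.
Qed.

Lemma bop_linC U V (c : R[i]) (f g : U -> V) : bop f -> bop g -> bop (c *: f + g).
Proof.
move=> /bopP[lf [C C0 fC]] /bopP[lg [D D0 gD]]; apply/bopP; split.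
  move=> a x y; rewrite !fctE /= lf lg !scalerDr addrACA !scalerA.
  by rewrite [a * c]mulrC.
exists (cm c * C + D) => [|x]; first by rewrite addr_ge0 // mulr_ge0 ?cm_ge0.
rewrite !fctE /= (le_trans (nmD _ _)) // nmZc mulrDl lerD //.
by rewrite -mulrA ler_wpM2l ?cm_ge0.
Qed.

Lemma preimage_closed_subspace U V (f : U -> V) (M : set V) :
  bop f -> closed_subspace M -> closed_subspace [set x | M (f x)].
Proof.
move=> /bopP[lf [C C0 fC]] [[M0 Ml] cM]; split; [split=> [|c x y Mx My]|].
- by rewrite /= lin0.
- by rewrite /= lf; exact: Ml.
move=> x /closure_nmP h; apply/cM/closure_nmP => e e0.
have C1 : 0 < C + 1 by rewrite ltr_wpDl.
have [y My xy] := h (e / (C + 1)) (divr_gt0 e0 C1).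
exists (f y) => //; rewrite -linB // (le_lt_trans (fC _)) //.
move: xy; rewrite ltr_pdivlMr //; apply: le_lt_trans.
by rewrite mulrC ler_wpM2l ?nm_ge0 // lerDl.
Qed.

Lemma bop_eq_on_closed_span U V (f g : U -> V) (X : set U) : bop f -> bop g ->
  (forall x, X x -> f x = g x) -> forall x, closed_span X x -> f x = g x.
Proof.
move=> bf bg fg x Xx; apply: ip_inj => v; apply/eqP.
rewrite -(subr_eq0 (ip v _)) -!adjPl // -ipBl; apply/eqP; move: x Xx.
apply: orthogonal_closed_span => x Xx.
by rewrite ipBl !adjPl // fg // subrr.
Qed.

End Adjoint.

(** * Neumann series *)

Section Neumann.
Variables (R : realType) (U : hilbertType R) (T : U -> U) (r : R).
Hypotheses (lT : linear T) (r0 : 0 <= r) (r1 : r < 1).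
Hypothesis Tr : forall x, nm (T x) <= r * nm x.

(** The n-th partial sum of the series of powers of T, in Horner form: an
    induction on n then only composes with T and adds the identity, which
    keeps it inside an algebra that contains T. *)
Definition neumann_sum n : U -> U := iter n (fun S => id + (T \o S)) 0.

Lemma neumann_sumS n x : neumann_sum n.+1 x = x + T (neumann_sum n x).
Proof. by []. Qed.

Let q := (1 - r)^-1.
Let q0 : 0 <= q. Proof. by rewrite invr_ge0 subr_ge0 ltW. Qed.
Let qE : q = 1 + r * q.
Proof. by rewrite /q; field; rewrite subr_eq0 gt_eqF. Qed.

(** The constant q = (1 - r)^-1 satisfies q = 1 + r q, which is what the
    induction step needs. *)
Lemma neumann_sum_bound n x : nm (neumann_sum n x) <= q * nm x.
Proof.
elim: n => [|n IH]; first by rewrite /= nm0 mulr_ge0 ?nm_ge0.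
rewrite neumann_sumS (le_trans (nmD _ _)) // qE mulrDl mul1r lerD2l.
by rewrite (le_trans (Tr _)) // -mulrA ler_wpM2l.
Qed.

Lemma neumann_sum_cauchy n k x :
  nm (neumann_sum (n + k) x - neumann_sum n x) <= r ^+ n * q * nm x.
Proof.
elim: n => [|n IH].
  by rewrite expr0 mul1r subr0 neumann_sum_bound.
rewrite addSn !neumann_sumS opprD addrACA subrr add0r -linB //.
by rewrite (le_trans (Tr _)) // exprS -!mulrA ler_wpM2l // mulrA.
Qed.

Lemma expr_small (e : R) : 0 < e -> exists N, forall n, (N <= n)%N -> r ^+ n < e.
Proof.
move=> e0; have : (fun n => r ^+ n) @ \oo --> (0 : R).
  by apply: cvg_expr; rewrite ger0_norm.
move=> /cvgrPdist_lt /(_ e e0) [N _ hN]; exists N => n nN.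
by have := hN n nN; rewrite /= sub0r normrN ger0_norm ?exprn_ge0.
Qed.

Let small (x : U) (e : R) : 0 < e ->
  exists N, forall n, (N <= n)%N -> r ^+ n * q * nm x < e.
Proof.
move=> e0; have p0 : 0 < q * nm x + 1 by rewrite ltr_wpDl ?mulr_ge0 ?nm_ge0.
have [|N hN] := @expr_small (e / (q * nm x + 1)); first exact: divr_gt0.
exists N => n /hN; rewrite ltr_pdivlMr //; apply: le_lt_trans.
by rewrite -mulrA ler_wpM2l ?exprn_ge0 // lerDl.
Qed.

Lemma neumann_limit x : exists y, forall n,
  nm (y - neumann_sum n x) <= r ^+ n * q * nm x.
Proof.
have [|y hy] := @complete_nm R U (neumann_sum ^~ x).
  move=> e e0; have e2 : 0 < e / 2 by rewrite divr_gt0.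
  have [N hN] := small x e2; exists N => m n mN nN.
  have := neumann_sum_cauchy N (m - N) x; have := neumann_sum_cauchy N (n - N) x.
  rewrite !subnKC // [in X in X -> _]nmBC => h1 h2.
  have := nmB_tri (neumann_sum N x) (neumann_sum m x) (neumann_sum n x).
  have := hN _ (leqnn N).
  move: (nm _) (nm _) (nm _) (_ * nm x) h1 h2 => a b c d; lra.
exists y => n; rewrite -subr_le0; apply: (@le_eps _ _ 1) => // e e0.
have [N hN] := hy _ e0; have := hN (n + N)%N (leq_addl _ _).
have := neumann_sum_cauchy n N x; rewrite [in X in _ -> X -> _]nmBC.
have := nmB_tri (neumann_sum (n + N) x) y (neumann_sum n x).
move: (nm _) (nm _) (nm _) (_ * nm x) => a b c d; lra.
Qed.

Lemma neumann : exists G : U -> U,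
  [/\ bop G /\ (id - T) \o G = id /\ G \o (id - T) = id,
      forall x, G x = x + T (G x) &
      forall n x, nm (G x - neumann_sum n x) <= r ^+ n * q * nm x].
Proof.
have /choice[G GP] := neumann_limit.
have T_inj x y : x - T x = y - T y -> x = y.
  move=> e; apply/eqP; rewrite -subr_eq0; apply/eqP/nm_eq0/eqP.
  rewrite eq_le nm_ge0 andbT.
  have e' : x - y = T (x - y).
    by rewrite linB // -[in LHS](subrK (T x) x) e addrAC [y - _]addrC addrK addrC.
  have := Tr (x - y); rewrite -e' -subr_le0 -[X in X - _]mul1r -mulrBl.
  by rewrite pmulr_rle0 // subr_gt0.
have fixG x : G x = x + T (G x).
  apply/eqP; rewrite -subr_eq0; apply/eqP/nm_eq0/eqP; rewrite eq_le nm_ge0 andbT.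
  apply: (@le_eps _ _ 2) => // e e0; have [N hN] := small x e0.
  have h1 := GP x N; have h2 := GP x N.+1; have hN1 := hN _ (leqnn N).
  have hN2 := hN _ (leqnSn N).
  have h3 : nm (x + T (G x) - neumann_sum N.+1 x) <= nm (G x - neumann_sum N x).
    rewrite neumann_sumS opprD addrACA subrr add0r -linB //.
    by rewrite (le_trans (Tr _)) // ler_piMl ?nm_ge0 // ltW.
  have := nmB_tri (neumann_sum N.+1 x) (G x) (x + T (G x)).
  rewrite [nm (neumann_sum _ _ - (_ + _))]nmBC.
  move: (r ^+ N * q * nm x) (r ^+ N.+1 * q * nm x) h1 h2 h3 hN1 hN2.
  move: (nm _) (nm _) (nm _) (nm _).
  move=> *; lra.
have fixB x : G x - T (G x) = x by rewrite {1}fixG addrK.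
have lG : linear G.
  move=> c x y; apply: T_inj; rewrite (linD _ _ lT) (linZ _ _ lT).
  by rewrite opprD addrACA -scalerBr !fixB.
exists G; split=> //; split.
  apply/bopP; split=> //; exists q => // x.
  by have := GP x 0%N; rewrite expr0 mul1r subr0.
split; apply/funext => x /=; rewrite !fctE /=.
  exact: fixB.
by apply: T_inj; rewrite fixB.
Qed.

Lemma opinv_neumann : [/\ bop (opinv (id - T)),
  forall x, opinv (id - T) x = x + T (opinv (id - T) x) &
  forall n x, nm (opinv (id - T) x - neumann_sum n x) <=
              r ^+ n * (1 - r)^-1 * nm x].
Proof.
have [G [[bG [TG GT]] fG aG]] := neumann.
suff -> : opinv (id - T) = G by [].
rewrite /opinv; case: xgetP => [g _ [_ [_ gT]]|/(_ G)]; last by case.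
apply/funext => x; have := congr1 (@^~ (G x)) gT => /= <-.
by have /= -> := congr1 (@^~ x) TG.
Qed.

End Neumann.

(** * Extension of isometries *)

Section IsometricExtension.
Variables (R : realType) (U V : hilbertType R) (I : Type).
Variables (u : I -> U) (v : I -> V).
Hypothesis gram : forall i j, ip (u i) (u j) = ip (v i) (v j).
Hypothesis total : closed_span (range u) = setT.

Let comb (W : hilbertType R) (w : I -> W) (s : seq (R[i] * I)) : W :=
  \sum_(p <- s) p.1 *: w p.2.

Let comb_lin (W : hilbertType R) (w : I -> W) c s t :
  comb w ([seq (c * p.1, p.2) | p <- s] ++ t) = c *: comb w s + comb w t.
Proof.
rewrite /comb big_cat big_map scaler_sumr; congr (_ + _).
by apply: eq_bigr => p _; rewrite scalerA.
Qed.

Let comb_ip s t : ip (comb u s) (comb u t) = ip (comb v s) (comb v t).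
Proof.
rewrite !ip_suml; apply: eq_bigr => p _; rewrite !ip_sumr.
by apply: eq_bigr => p' _; rewrite !ipZl !ipZr gram.
Qed.

(* The graph of the extension: the closure of the pairs of equal linear
   combinations of the u i and of the v i. *)
Let rel x q := forall e : R, 0 < e ->
  exists2 s, nm (x - comb u s) < e & nm (q - comb v s) < e.

Let rel_nm x q : rel x q -> nm q = nm x.
Proof.
move=> h.
suff k (e : R) : 0 < e -> nm q - nm x <= e * 2 /\ nm x - nm q <= e * 2.
  apply/eqP; rewrite eq_le -!(subr_le0 (nm _)).
  by apply/andP; split; apply: (@le_eps _ _ 2) => // e e0; case: (k e e0).
move=> e0; have [s xs qs] := h e e0.
have E : nm (comb v s) = nm (comb u s) by apply/nm_eq_ip/esym/comb_ip.
have := nmD (x - comb u s) (comb u s); rewrite subrK.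
have := nmD (q - comb v s) (comb v s); rewrite subrK E.
have := nmD (comb u s - x) x; rewrite subrK [nm (_ - x)]nmBC.
have := nmD (comb v s - q) q; rewrite subrK [nm (_ - q)]nmBC E.
move: (nm (x - _)) (nm (q - _)) xs qs => a b.
by move: (nm _) (nm _) (nm _) => *; split; lra.
Qed.

Let rel_lin c x q x' q' : rel x q -> rel x' q' -> rel (c *: x + x') (c *: q + q').
Proof.
move=> h h' e e0; have c1 : 0 < cm c + 1 by rewrite ltr_wpDl ?cm_ge0.
have e2 : 0 < e / 2 by rewrite divr_gt0.
have e3 : 0 < e / 2 / (cm c + 1) by rewrite divr_gt0.
have [s xs qs] := h _ e3; have [s' xs' qs'] := h' _ e2.
exists ([seq (c * p.1, p.2) | p <- s] ++ s').
all: rewrite comb_lin opprD addrACA -scalerBr.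
all: apply: le_lt_trans (nmD _ _) _; rewrite nmZc.
- have : cm c * nm (x - comb u s) <= e / 2.
    move: xs; rewrite ltr_pdivlMr // => /ltW; apply: le_trans.
    by rewrite mulrC ler_wpM2l ?nm_ge0 // lerDl.
  by move=> k; rewrite [e]splitr ler_ltD.
- have : cm c * nm (q - comb v s) <= e / 2.
    move: qs; rewrite ltr_pdivlMr // => /ltW; apply: le_trans.
    by rewrite mulrC ler_wpM2l ?nm_ge0 // lerDl.
  by move=> k; rewrite [e]splitr ler_ltD.
Qed.

Let rel_unique x q q' : rel x q -> rel x q' -> q = q'.
Proof.
move=> h h'; have := rel_nm (rel_lin (-1) h' h).
by rewrite !scaleN1r addNr nm0 addrC => /nm_eq0/subr0_eq.
Qed.

Let comb_dense x (e : R) : 0 < e -> exists s, nm (x - comb u s) < e.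
Proof.
move=> e0; have : closed_span (range u) x by rewrite total.
move=> /closure_nmP /(_ _ e0) [y yX xy].
suff [s ys] : exists s, y = comb u s by exists s; rewrite -ys.
have [n [c [w [wu ->]]]] := yX.
have /choice[i iP] : forall k, exists i, u i = w k.
  by move=> k; have [i _ <-] := wu k; exists i.
exists [seq (c k, i k) | k <- enum 'I_n].
rewrite /comb big_map big_enum; apply: eq_bigr => k _; by rewrite /= iP.
Qed.

Let rel_total x : exists q, rel x q.
Proof.
have [s sP] : exists s : nat -> seq (R[i] * I), forall n,
    nm (x - comb u (s n)) < n.+1%:R^-1.
  suff /choice : forall n : nat, exists s, nm (x - comb u s) < n.+1%:R^-1.
    by case=> f fP; exists f.
  by move=> n; apply: comb_dense; rewrite invr_gt0.
have [|q qP] := @complete_nm R V (fun n => comb v (s n)).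
  move=> e e0; have e2 : 0 < e / 2 by rewrite divr_gt0.
  have [N hN] := natSinv_small e2; exists N => m n mN nN.
  have -> : nm (comb v (s m) - comb v (s n)) = nm (comb u (s m) - comb u (s n)).
    have cE (W : hilbertType R) (w : I -> W) : comb w (s m) - comb w (s n)
        = comb w ([seq (-1 * p.1, p.2) | p <- s n] ++ s m).
      by rewrite comb_lin scaleN1r addrC.
    by rewrite !cE; apply/nm_eq_ip/esym/comb_ip.
  have := nmB_tri x (comb u (s m)) (comb u (s n)); rewrite [nm (_ - x)]nmBC.
  have := hN _ mN; have := hN _ nN; have := sP m; have := sP n.
  move: (_^-1) (_^-1) (nm _) (nm _) (nm _) => *; lra.
exists q => e e0; have [N hN] := natSinv_small e0; have [N' hN'] := qP _ e0.
exists (s (maxn N N')); last by rewrite nmBC hN' // leq_maxr.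
by apply: lt_trans (sP _) (hN _ _); rewrite leq_maxl.
Qed.

(** Combinations of the v i that match a Cauchy sequence of combinations of
    the u i are Cauchy too, because equal Gram matrices give equal norms. *)
Lemma isometric_extension : exists G : U -> V,
  [/\ linear G, forall x y, ip (G x) (G y) = ip x y & forall i, G (u i) = v i].
Proof.
have /choice[G GP] := rel_total.
have lG : linear G.
  by move=> c x y; apply: rel_unique (GP _) _; apply: rel_lin.
have nG x : nm (G x) = nm x by exact: rel_nm.
have ReG x y : complex.Re (ip (G x) (G y)) = complex.Re (ip x y).
  have := nG (x + y); rewrite linD // => /(congr1 (fun t => t ^+ 2)).
  by rewrite !nmD_sq !nG; lra.
exists G; split=> // [x y|i].
  apply/eqP; rewrite eq_complex ReG eqxx /=.
  have := ReG ('i%C *: x) y; rewrite linZ // !ipZl.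
  by case: (ip _ _) (ip _ _) => a b [c d]; simpc => /= ->.
apply: rel_unique (GP _) _ => e e0; exists [:: (1, i)].
  by rewrite /comb big_seq1 scale1r subrr nm0.
by rewrite /comb big_seq1 scale1r subrr nm0.
Qed.

End IsometricExtension.

(** * Solutions of k = h + A k *)

Section NeumannRemainder.
Variables (R : realType).
Implicit Types U V : hilbertType R.

Lemma iter_linear U (A : U -> U) n : linear A -> linear (iter n A).
Proof.
move=> lA; elim: n => [c x y|n IH c x y] //.
by rewrite !iterS IH lA.
Qed.

Lemma iter_bound U (A : U -> U) (r : R) n x : 0 <= r ->
  (forall y, nm (A y) <= r * nm y) -> nm (iter n A x) <= r ^+ n * nm x.
Proof.
move=> r0 Ar; elim: n => [|n IH]; first by rewrite expr0 mul1r.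
by rewrite iterS (le_trans (Ar _)) // exprS -mulrA ler_wpM2l.
Qed.

Lemma fixpoint_expand U (A : U -> U) h k n : linear A -> k = h + A k ->
  k = \sum_(m < n) iter m A h + iter n A k.
Proof.
move=> lA e; elim: n => [|n IH]; first by rewrite big_ord0 add0r.
rewrite big_ord_recr /= {1}IH -addrA; congr (_ + _).
by rewrite {1}e -iterS iterSr linD //; exact: iter_linear.
Qed.

Lemma neumann_mem U (A : U -> U) (r : R) (M : set U) h k :
  linear A -> 0 <= r -> r < 1 -> (forall y, nm (A y) <= r * nm y) ->
  closed_subspace M -> k = h + A k -> (forall m, M (iter m A h)) -> M k.
Proof.
move=> lA r0 r1 Ar [sM cM] e hM; apply/cM/closure_nmP => ep ep0.
have k1 : 0 < nm k + 1 by rewrite ltr_wpDl ?nm_ge0.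
have [|N hN] := @expr_small R r r0 r1 (ep / (nm k + 1)); first exact: divr_gt0.
exists (\sum_(m < N) iter m A h); first exact: subspace_sum.
rewrite {1}(fixpoint_expand N lA e) addrC addKr.
apply: le_lt_trans (iter_bound _ _ r0 Ar) _.
have := hN _ (leqnn N); rewrite ltr_pdivlMr //; apply: le_lt_trans.
by rewrite ler_wpM2l ?exprn_ge0 // lerDl.
Qed.

(** Both solutions are compared after n steps of their expansion; the
    remainders A^n k and B^n k' have norm of order r^n. *)
Lemma neumann_ip_eq U V (A : U -> U) (B : V -> V) (r : R) e h k e' h' k' :
  linear A -> linear B -> 0 <= r -> r < 1 ->
  (forall y, nm (A y) <= r * nm y) -> (forall y, nm (B y) <= r * nm y) ->
  k = h + A k -> k' = h' + B k' ->
  (forall m, ip e (iter m A h) = ip e' (iter m B h')) -> ip e k = ip e' k'.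
Proof.
move=> lA lB r0 r1 Ar Br ek ek' E.
apply/eqP; rewrite -subr_eq0; apply/eqP/cm_eq0/eqP.
rewrite eq_le cm_ge0 andbT.
apply: (@le_eps _ _ (nm e * nm k + nm e' * nm k')).
  by rewrite addr_ge0 ?mulr_ge0 ?nm_ge0.
move=> ep ep0; have [N hN] := @expr_small R r r0 r1 ep ep0.
have -> : ip e k = \sum_(m < N) ip e (iter m A h) + ip e (iter N A k).
  by rewrite {1}(fixpoint_expand N lA ek) ipDr ip_sumr.
have -> : ip e' k' = \sum_(m < N) ip e' (iter m B h') + ip e' (iter N B k').
  by rewrite {1}(fixpoint_expand N lB ek') ipDr ip_sumr.
rewrite (eq_bigr _ (fun (i : 'I_N) _ => E i)) opprD addrACA subrr add0r.
have rN := ltW (hN _ (leqnn N)).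
rewrite (le_trans (cmD _ _)) // cmN mulrDr lerD //.
all: rewrite (le_trans (cauchy_schwarz _ _)) // mulrCA ler_wpM2l ?nm_ge0 //.
- by rewrite (le_trans (iter_bound _ _ r0 Ar)) // ler_wpM2r ?nm_ge0.
- by rewrite (le_trans (iter_bound _ _ r0 Br)) // ler_wpM2r ?nm_ge0.
Qed.

(** The vectors k t have the power series expansion k t = sum of t^m A^m h,
    and x is orthogonal to all of them.  If the coefficients of order below m
    vanish, the one of order m is bounded by a multiple of t, because the
    remainder of order m + 1 is; let t tend to zero. *)
Lemma neumann_coef_eq0 U (A : U -> U) x h (k : R -> U) :
  linear A -> (forall y, nm (A y) <= nm y) ->
  (forall t : R, 0 < t <= 2^-1 -> k t = h + t%:C *: A (k t)) ->
  (forall t : R, 0 < t <= 2^-1 -> ip x (k t) = 0) ->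
  forall m, ip x (iter m A h) = 0.
Proof.
move=> lA A1 kE xk.
have kB (t : R) : 0 < t <= 2^-1 -> nm (k t) <= 2 * nm h.
  move=> tI; have /andP[t0 t2] := tI.
  have : nm (k t) <= nm h + t * nm (k t).
    rewrite {1}(kE t tI) (le_trans (nmD _ _)) // lerD2l nmZc cmR gtr0_norm //.
    by rewrite ler_wpM2l // ltW.
  have : t * nm (k t) <= 2^-1 * nm (k t) by rewrite ler_wpM2r ?nm_ge0.
  by move: (nm _) (nm _) => *; lra.
have iterZ (t : R) n y : iter n (fun z => t%:C *: A z) y = (t ^+ n)%:C *: iter n A y.
  elim: n => [|n IH]; first by rewrite expr0 scale1r.
  by rewrite !iterS IH (linZ _ _ lA) scalerA -rmorphM exprS.
elim/ltn_ind => m IH.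
apply/cm_eq0/eqP; rewrite eq_le cm_ge0 andbT.
pose C := nm x * (2 * nm h).
have C0 : 0 <= C by rewrite !mulr_ge0 ?nm_ge0.
apply: (@le_eps _ _ C) => // e e0.
pose t := Num.min e 2^-1.
have t0 : 0 < t by rewrite lt_min e0 invr_gt0 ltr0n.
have tI : 0 < t <= 2^-1 by rewrite t0 ge_min lexx orbT.
have lB : linear (fun z => t%:C *: A z).
  by move=> c y z; rewrite lA scalerDr !scalerA mulrC.
have := xk t tI; rewrite {1}(fixpoint_expand m.+1 lB (kE t tI)) ipDr ip_sumr.
rewrite big_ord_recr big1 /= => [|i _]; last first.
  by rewrite iterZ ipZr IH // mulr0.
rewrite add0r !iterZ (linZ _ _ lA) scalerA -rmorphM -exprS -iterS !ipZr.
move=> /eqP; rewrite addr_eq0 => /eqP/(congr1 cm).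
rewrite cmN !cmM !cmR !ger0_norm ?exprn_ge0 ?(ltW t0) // exprSr -mulrA.
move/mulfI => ->; last by rewrite expf_neq0 // gt_eqF.
apply: le_trans (ler_wpM2l (ltW t0) (cauchy_schwarz _ _)) _.
apply: ler_pM; [exact: ltW|by rewrite mulr_ge0 ?nm_ge0|by rewrite ge_min lexx|].
rewrite ler_wpM2l ?nm_ge0 // (le_trans _ (kB t tI)) //.
rewrite -[nm (k t)]mul1r -(expr1n _ m.+1); apply: iter_bound => // y.
by rewrite mul1r.
Qed.

End NeumannRemainder.

(** * Words and symmetrized monomials *)

Section Words.
Variables (R : realType) (d : nat).
Implicit Types (z w : 'rV[R[i]]_d) (n : 'I_d -> nat).

Lemma prod_count (w : 'I_d -> R[i]) (s : seq 'I_d) :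
  \prod_(i <- s) w i = \prod_i w i ^+ count_mem i s.
Proof.
elim: s => [|j s IH]; first by rewrite big_nil big1 // => i _; rewrite expr0.
rewrite big_cons IH (bigD1 j) //= [in RHS](bigD1 j) //= mulrA eqxx exprS.
congr (_ * _); apply: eq_bigr => i /negbTE ij.
by rewrite eq_sym ij.
Qed.

Lemma sum_count (s : seq 'I_d) : (\sum_i count_mem i s)%N = size s.
Proof.
elim: s => [|j s IH] /=; first by rewrite big1.
rewrite big_split /= IH (bigD1 j) //= eqxx big1 // => i /negbTE ij.
by rewrite eq_sym ij.
Qed.

Lemma base_expansion_inj N e (a b : 'I_e -> nat) :
  (forall i, a i < N)%N -> (forall i, b i < N)%N ->
  (\sum_i a i * N ^ i = \sum_i b i * N ^ i)%N -> a =1 b.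
Proof.
elim: e a b => [|e IH] a b aN bN; first by move=> _ [].
rewrite !big_ord_recl /= !expn0 !muln1.
have E c : (\sum_(i < e) c (lift ord0 i) * N ^ bump 0 i)%N =
  ((\sum_(i < e) c (lift ord0 i) * N ^ i) * N)%N.
  by rewrite big_distrl /=; apply: eq_bigr => i _; rewrite -mulnA -expnSr.
rewrite (E a) (E b) => h.
have N0 : (0 < N)%N by apply: leq_trans (aN ord0).
have h0 : a ord0 = b ord0.
  by have := congr1 (modn^~ N) h; rewrite !(addnC (_ ord0)) !modnMDl !modn_small.
have hs : (\sum_(i < e) a (lift ord0 i) * N ^ i =
           \sum_(i < e) b (lift ord0 i) * N ^ i)%N.
  by move: h; rewrite h0 => /addnI/eqP; rewrite eqn_pmul2r // => /eqP.
move=> i; case: (unliftP ord0 i) => [j ->|-> //].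
by apply: (IH (a \o lift ord0) (b \o lift ord0)) => [k|k|]; [exact: aN|exact: bN|].
Qed.

Lemma poly_infinite_roots (p : {poly R[i]}) (m : nat) :
  (forall s : nat, p.[((m + s)%:R)^-1] = 0) -> (0 < m)%N -> p = 0.
Proof.
move=> pr m0; apply/eqP; apply: contraT => p0.
have := @max_poly_roots _ p [seq ((m + s)%:R)^-1 | s <- iota 0 (size p)] p0.
rewrite size_map size_iota ltnn => -> //.
  by apply/allP => _ /mapP[s _ ->]; rewrite /root pr.
rewrite map_inj_uniq ?iota_uniq // => s t /invr_inj/eqP.
by rewrite eqr_nat eqn_add2l => /eqP.
Qed.

(** Substitute w_i = x^(N^i), where N exceeds every number of occurrences of a
    letter: a word of type n then contributes to the power of x with exponent
    the number whose digits in base N are the n_i.  The resulting polynomial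
    in one variable vanishes at infinitely many points x, and its coefficients
    are the sums over words of a given type. *)
Lemma word_coef_eq0 m (c : m.-tuple 'I_d -> R[i]) :
  (forall w, unit_ball w ->
    \sum_(alpha : m.-tuple 'I_d) (\prod_(i <- alpha) (w 0 i)^*) * c alpha = 0) ->
  forall n, \sum_(alpha : m.-tuple 'I_d | [forall i, count_mem i alpha == n i])
    c alpha = 0.
Proof.
move=> h n; pose N := m.+1.
pose e (a : m.-tuple 'I_d) := (\sum_(i < d) count_mem i a * N ^ i)%N.
have countN (a : m.-tuple 'I_d) i : (count_mem i a < N)%N.
  by rewrite ltnS -[in X in (_ <= X)%N](size_tuple a) count_size.
pose p : {poly R[i]} := \sum_(a : m.-tuple 'I_d) c a *: 'X^(e a).
have p0 : p = 0.
  apply: (@poly_infinite_roots p d.+1) => // s.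
  (* For x below 1 / d the point w lies in the ball, since its coordinates are
     at most x <= 1. *)
  pose x : R := ((d.+1 + s)%:R)^-1.
  have xE : ((d.+1 + s)%:R)^-1 = x%:C :> R[i] by rewrite fmorphV rmorph_nat.
  have x0 : 0 < x by rewrite invr_gt0 ltr0n.
  have x1 : x <= 1 by rewrite invf_le1 ?ltr0n // ler1n.
  have xd : d%:R * x < 1.
    by rewrite mulrC ltr_pdivrMl ?ltr0n // mulr1 ltr_nat addSn ltnS leq_addr.
  pose w : 'rV[R[i]]_d := \row_i (x ^+ (N ^ i))%:C.
  have /h : unit_ball w.
    rewrite /unit_ball /= /dotC.
    rewrite (eq_bigr (fun i : 'I_d => ((x ^+ (N ^ i)) ^+ 2)%:C)); last first.
      by move=> i _; rewrite mxE conjR -rmorphM.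
    rewrite -rmorph_sum /= -(rmorph1 (real_complex R)) ltcR.
    apply: le_lt_trans xd; have -> : d%:R * x = \sum_(i < d) x.
      by rewrite sumr_const card_ord mulr_natl.
    apply: ler_sum => i _; rewrite -exprM -[leRHS]expr1.
    by apply: ler_wiXn2l; rewrite ?(ltW x0) // muln_gt0 expn_gt0.
  rewrite xE /p horner_sum => hw; rewrite -[RHS]hw; apply: eq_bigr => a _.
  rewrite hornerZ hornerXn mulrC prod_count; congr (_ * _).
  rewrite -prodrXr; apply: eq_bigr => i _.
  by rewrite mxE conjR rmorphXn -exprM mulnC.
have := congr1 (fun q : {poly R[i]} => q`_(\sum_(i < d) n i * N ^ i)) p0.
rewrite coef0 /p coef_sum => pc.
have [/existsP[i nN]|nN] := boolP [exists i, (N <= n i)%N].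
  apply: big1 => a /forallP/(_ i)/eqP e1.
  by have := countN a i; rewrite e1 ltnNge nN.
rewrite -[RHS]pc.
rewrite [RHS](bigID (fun a : m.-tuple 'I_d => [forall i, count_mem i a == n i])) /=.
rewrite [X in _ = _ + X]big1 ?addr0 => [|a /negP an].
  apply: eq_bigr => a /forallP an; rewrite coefZ coefXn.
  have -> : e a = (\sum_(i < d) n i * N ^ i)%N.
    by apply: eq_bigr => i _; rewrite (eqP (an i)).
  by rewrite eqxx mulr1.
rewrite coefZ coefXn; case: eqP => [ea|_]; last by rewrite mulr0.
case: an; apply/forallP => i; apply/eqP/esym.
move: i; apply: (base_expansion_inj (N := N)) ea => i //.
by rewrite ltnNge; apply: contra nN => k; apply/existsP; exists i.
Qed.

Section Operators.
Variable U : hilbertType R.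
Variable T : 'I_d -> U -> U.

Lemma op_conjE z x : op_conj T z x = \sum_i (z 0 i)^* *: T i x.
Proof. by rewrite /op_conj fct_sumE. Qed.

Hypothesis lT : forall i, linear (T i).

Lemma op_conj_linear z : linear (op_conj T z).
Proof.
move=> c x y; rewrite !op_conjE scaler_sumr -big_split; apply: eq_bigr => i _.
by rewrite lT scalerDr !scalerA mulrC.
Qed.

Lemma iter_op_conj z m x : iter m (op_conj T z) x =
  \sum_(alpha : m.-tuple 'I_d)
    (\prod_(i <- alpha) (z 0 i)^*) *: opword T alpha x.
Proof.
elim: m => [|m IH].
  rewrite (big_pred1 [tuple]) => [|a]; first by rewrite big_nil scale1r.
  by rewrite (tuple0 a) /= eqxx.
rewrite iterS IH op_conjE.
pose cns (p : 'I_d * m.-tuple 'I_d) : m.+1.-tuple 'I_d := [tuple of p.1 :: p.2].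
rewrite [RHS](reindex cns) /=; last first.
  exists (fun a : m.+1.-tuple 'I_d => (thead a, [tuple of behead a])).
    move=> [i a] _ /=.
    by congr pair; apply: val_inj.
  by move=> a _ /=; rewrite [RHS](tuple_eta a).
rewrite -(pair_bigA _ (fun i (a : m.-tuple 'I_d) =>
  (\prod_(j <- i :: a) (z 0 j)^*) *: opword T (i :: a) x)) /=.
apply: eq_bigr => i _; rewrite lin_sum // scaler_sumr; apply: eq_bigr => a _.
by rewrite big_cons (linZ _ _ (lT i)) scalerA.
Qed.

(** The words in [opsym] are tuples of length the sum of the n i; this changes
    that length to an equal one. *)
Lemma opsymE m n : (\sum_i n i)%N = m ->
  opsym T n = \sum_(alpha : m.-tuple 'I_d | [forall i, count_mem i alpha == n i])
    opword T alpha.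
Proof. by case: m /. Qed.

(** Words with the same numbers of occurrences carry the same coefficient, so
    that the m-th power of T w^* is a combination of symmetrized monomials of
    degree m. *)
Lemma iter_op_conj_mem z m x (M : set U) : subspace M ->
  (forall n, (\sum_i n i)%N = m -> M (opsym T n x)) -> M (iter m (op_conj T z) x).
Proof.
move=> sM nM; rewrite iter_op_conj.
pose f (a : m.-tuple 'I_d) := [ffun i => inord (count_mem i a) : 'I_m.+1].
have fE a i : f a i = count_mem i a :> nat.
  by rewrite ffunE inordK // ltnS -[in X in (_ <= X)%N](size_tuple a) count_size.
rewrite (partition_big f xpredT) //=; apply: subspace_sum => // g _.
rewrite (eq_bigr (fun a : m.-tuple 'I_d =>
  (\prod_i ((z 0 i)^* ^+ g i)) *: opword T a x)); last first.
  move=> a /eqP <-; rewrite prod_count; congr (_ *: _).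
  by apply: eq_bigr => i _; rewrite fE.
rewrite -scaler_sumr; apply: subspaceZ => //.
have fg (a : m.-tuple 'I_d) : (f a == g) = [forall i, count_mem i a == g i].
  apply/eqP/forallP => [<- i|h]; first by rewrite fE.
  by apply/ffunP => i; apply/val_inj; rewrite /= fE (eqP (h i)).
rewrite (eq_bigl _ _ fg).
have [e|ne] := eqVneq (\sum_i g i)%N m.
  by have := nM (fun i => g i : nat) e; rewrite (opsymE e) fct_sumE.
(* No word of length m has occurrence numbers that do not add up to m. *)
rewrite big1 => [|a /forallP h]; first by case: sM.
case/eqP: ne; rewrite -[RHS](size_tuple a) -[RHS]sum_count.
by apply: eq_bigr => i _; rewrite (eqP (h i)).
Qed.

End Operators.
End Words.

(** * Row operators *)

Section RowOperators.
Variables (R : realType) (d : nat) (U : hilbertType R).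
Implicit Types (z w : 'rV[R[i]]_d) (T : 'I_d -> U -> U) (f g : 'I_d -> U).

Definition radius z : R := Num.sqrt (\sum_i cm (z 0 i) ^+ 2).

Lemma dotCE z : dotC z z = (radius z ^+ 2)%:C.
Proof.
rewrite /dotC sqr_sqrtr ?sumr_ge0 // => [|i _]; last exact: sqr_ge0.
by rewrite rmorph_sum; apply: eq_bigr => i _; rewrite mulCJ.
Qed.

Lemma radius_ge0 z : 0 <= radius z.
Proof. exact: sqrtr_ge0. Qed.

Lemma radius_lt1 z : unit_ball z -> radius z < 1.
Proof.
rewrite /unit_ball /= dotCE -(rmorph1 (real_complex R)) ltcR => h.
by rewrite -(@ltr_pXn2r _ 2) ?nnegrE ?radius_ge0 // expr1n.
Qed.

Lemma unit_ball_scale (t : R) z :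
  0 <= t <= 1 -> unit_ball z -> unit_ball (t%:C *: z).
Proof.
move=> /andP[t0 t1] zB; rewrite /unit_ball /=.
have -> : dotC (t%:C *: z) (t%:C *: z) = (t ^+ 2 * radius z ^+ 2)%:C.
  rewrite [RHS]rmorphM /= -dotCE /dotC mulr_sumr; apply: eq_bigr => i _.
  by rewrite !mxE rmorphM /= conjR mulrACA -rmorphM.
rewrite -(rmorph1 (real_complex R)) ltcR -exprMn exprn_ilt1 //.
  by rewrite mulr_ge0 ?radius_ge0.
apply: le_lt_trans (radius_lt1 zB); rewrite ler_piMl //; exact: radius_ge0.
Qed.

Definition row_contraction T :=
  forall f, nm (row_op T f) ^+ 2 <= \sum_i nm (f i) ^+ 2.

Definition row_isometry T :=
  forall i j x y, ip (T i x) (T j y) = (i == j)%:R * ip x y.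

Lemma op_conj_row T z x : (forall i, linear (T i)) ->
  op_conj T z x = row_op T (fun j => (z 0 j)^* *: x).
Proof.
move=> lT; rewrite op_conjE; apply: eq_bigr => i _.
by rewrite (linZ _ _ (lT i)).
Qed.

Lemma nm_op_conj T z x : (forall i, linear (T i)) -> row_contraction T ->
  nm (op_conj T z x) <= radius z * nm x.
Proof.
move=> lT cT; rewrite -(@ler_pXn2r _ 2) ?nnegrE ?mulr_ge0 ?nm_ge0 ?radius_ge0 //.
rewrite op_conj_row // (le_trans (cT _)) // exprMn sqr_sqrtr; last first.
  by apply: sumr_ge0 => i _; exact: sqr_ge0.
rewrite mulr_suml; apply: ler_sum => i _.
by rewrite nmZc exprMn cmJ.
Qed.

Lemma row_isometry_ip T f g : row_isometry T ->
  ip (row_op T f) (row_op T g) = \sum_i ip (f i) (g i).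
Proof.
move=> iT; rewrite ip_suml; apply: eq_bigr => i _.
rewrite ip_sumr (bigD1 i) //= iT eqxx mul1r big1 ?addr0 // => j ji.
by rewrite iT eq_sym (negbTE ji) mul0r.
Qed.

Lemma row_isometry_contraction T : row_isometry T -> row_contraction T.
Proof.
move=> iT f; rewrite nm_sq row_isometry_ip // raddf_sum.
by apply: ler_sum => i _; rewrite nm_sq.
Qed.

(** Density is used in one argument at a time; moving T i or T j to the other
    side turns the claim into orthogonality to a fixed vector. *)
Lemma row_isometry_total T (X : set U) : (forall i, bop (T i)) ->
  closed_span X = setT ->
  (forall i j x y, X x -> X y -> ip (T i x) (T j y) = (i == j)%:R * ip x y) ->
  row_isometry T.
Proof.
move=> bT tX h.
have dense u : (forall x, X x -> ip u x = 0) -> forall y, ip u y = 0.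
  by move=> uX y; apply: (orthogonal_closed_span uX); rewrite tX.
have natJ (n : nat) : (n%:R : R[i])^* = n%:R by rewrite rmorph_nat.
have step x i j y : X x -> ip (T i x) (T j y) = (i == j)%:R * ip x y.
  move=> Xx; apply/eqP; rewrite -subr_eq0 -adjPl // -natJ -ipZl -ipBl.
  apply/eqP/dense => v Xv.
  by rewrite ipBl ipZl natJ adjPl // h // subrr.
move=> i j x y; pose u := adj (T i) (T j y) - (i == j)%:R *: y.
have : ip u x = 0.
  apply: dense => v Xv; rewrite ipBl ipZl natJ adjPl //.
  by rewrite [ip (T j y) _]ip_conj step // rmorphM rmorph_nat /= -ip_conj subrr.
rewrite /u ipBl ipZl natJ adjPl // => /eqP; rewrite subr_eq0 => /eqP e.
by rewrite ip_conj e rmorphM rmorph_nat /= -ip_conj.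
Qed.

End RowOperators.

(** Only finitely many coordinates are involved, so that pointwise
    approximation can be made uniform in them. *)
Lemma ptws_closure (R : realType) (d : nat) (K : hilbertType R)
    (A : set ('I_d -> K)) m : closure (A : set {ptws 'I_d -> K}) m ->
  forall e : R, 0 < e -> exists2 a, A a & forall i, nm (m i - a i) <= e.
Proof.
move=> clm e e0; pose P i := [set a : {ptws 'I_d -> K} | nm (m i - a i) <= e].
have Pm i : nbhs (m : {ptws 'I_d -> K}) (P i).
  have B : nbhs (m i) [set y | nm (m i - y) <= e].
    apply/nbhs_ballP; exists e%:C; first by rewrite /= ltcR.
    by move=> y; rewrite -ball_normE /= nmE ltcR => /ltW.
  exact: (@proj_continuous _ (fun=> K) i m _ B).
have [a [Aa aP]] := clm _ (filter_forall _ Pm).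
by exists a.
Qed.

(** * Row partial isometries *)

Section PartialIsometry.
Variables (R : realType) (d : nat) (K : hilbertType R).
Variables (V : 'I_d -> K -> K) (G : set ('I_d -> K)).
Implicit Types (f g m : 'I_d -> K).
Hypothesis bV : forall j, bop (V j).
Hypothesis pV : partial_isometry_with_initial_space V
  (closure (lspan G : set {ptws 'I_d -> K})).

(** The inner product of the direct sum of d copies of K; [Vs] is V^* for it. *)
Let sp f g : R[i] := \sum_i ip (f i) (g i).
Let Vs e : 'I_d -> K := fun i => adj (V i) e.

Let sp_adj f e : ip (row_op V f) e = sp f (Vs e).
Proof. by rewrite ip_suml; apply: eq_bigr => i _; rewrite adjP. Qed.

Let spDl f g m : sp (f + g) m = sp f m + sp g m.
Proof. by rewrite -big_split; apply: eq_bigr => i _; rewrite ipDl. Qed.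
Let spDr f g m : sp m (f + g) = sp m f + sp m g.
Proof. by rewrite -big_split; apply: eq_bigr => i _; rewrite ipDr. Qed.
Let spZl c f m : sp (c *: f) m = c^* * sp f m.
Proof. by rewrite mulr_sumr; apply: eq_bigr => i _; rewrite ipZl. Qed.
Let spZr c f m : sp m (c *: f) = c * sp m f.
Proof. by rewrite mulr_sumr; apply: eq_bigr => i _; rewrite ipZr. Qed.
Let sp_conj f g : sp f g = (sp g f)^*.
Proof. by rewrite rmorph_sum; apply: eq_bigr => i _; rewrite ip_conj. Qed.

Let rowD f g : row_op V (f + g) = row_op V f + row_op V g.
Proof.
by rewrite -big_split; apply: eq_bigr => i _; rewrite linD //; case: (bV i).
Qed.
Let rowZ c f : row_op V (c *: f) = c *: row_op V f.
Proof.
by rewrite scaler_sumr; apply: eq_bigr => i _; rewrite linZ //; case: (bV i).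
Qed.

(** Polarization: the defect D of the isometry property satisfies D f g + D g
    f = 0, and replacing g by i g gives D f g = D g f. *)
Let isom f g : lspan G f -> lspan G g -> ip (row_op V f) (row_op V g) = sp f g.
Proof.
move=> Gf Gg; have sG := lspan_subspace G.
have pV1 h : lspan G h -> ip (row_op V h) (row_op V h) = sp h h.
  by move=> Gh; apply: pV.1; exact: subset_closure.
pose D a b := ip (row_op V a) (row_op V b) - sp a b.
have DD a b : lspan G a -> lspan G b -> D a b + D b a = 0.
  move=> Ga Gb; have := pV1 (a + b) (subspaceD sG Ga Gb).
  rewrite rowD !ipDl !ipDr !spDl !spDr !pV1 // => h.
  have -> : D a b + D b a = sp a a + ip (row_op V a) (row_op V b) +
      (ip (row_op V b) (row_op V a) + sp b b) -
      (sp a a + sp a b + (sp b a + sp b b)).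
    rewrite /D; ring.
  by rewrite h subrr.
have D1 := DD f g Gf Gg.
have [j [j0 jC]] : exists j : R[i], j != 0 /\ j^* = - j.
  by exists 'i; rewrite conjCi neq0Ci.
have := DD f (j *: g) Gf (subspaceZ j sG Gg).
rewrite /D rowZ !ipZl !ipZr !spZl !spZr jC.
move=> D2; have /eqP : j * (D f g - D g f) = 0 by rewrite -[RHS]D2 /D; ring.
rewrite mulf_eq0 (negbTE j0) subr_eq0 => /eqP {}D2.
move/eqP: D1; rewrite -D2 -mulr2n mulrn_eq0 /= => /eqP D0.
by apply/eqP; rewrite -subr_eq0; apply/eqP.
Qed.

Let orth_init g : (forall m, G m -> sp m g = 0) ->
  forall m, closure (lspan G : set {ptws 'I_d -> K}) m -> sp m g = 0.
Proof.
move=> h.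
have h' m : lspan G m -> sp m g = 0.
  apply: (lspan_min (M := [set m | sp m g = 0])) => //.
  split=> [|c a b /=]; first by rewrite /sp /= big1 // => i _; rewrite ip0l.
  by rewrite spDl spZl => -> ->; rewrite mulr0 addr0.
move=> m clm; apply/cm_eq0/eqP; rewrite eq_le cm_ge0 andbT.
apply: (@le_eps _ _ (\sum_i nm (g i))).
  by apply: sumr_ge0 => i _; exact: nm_ge0.
move=> e e0.
have [a Ga am] := ptws_closure clm e0.
rewrite -[sp m g]subr0 -(h' a Ga).
have -> : sp m g - sp a g = sp (m - a) g.
  by rewrite /sp -sumrB; apply: eq_bigr => i _; rewrite -ipBl.
rewrite /sp mulr_sumr.
have cm_sum (F : 'I_d -> R[i]) : cm (\sum_i F i) <= \sum_i cm (F i).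
  exact: (@nm_sum R R[i]^o).
rewrite (le_trans (cm_sum _)) //; apply: ler_sum => i _.
by rewrite (le_trans (cauchy_schwarz _ _)) // ler_wpM2r ?nm_ge0 ?am.
Qed.

Let kernel_row g : (forall m, G m -> sp m g = 0) -> row_op V g = 0.
Proof. by move=> h; apply: pV.2; exact: orth_init. Qed.

Let sp_eq0 f : sp f f = 0 -> forall i, f i = 0.
Proof.
move=> s0 i; apply: ipxx_eq0; move/eqP: s0; rewrite psumr_eq0 => [/allP|j _].
  by move=> /(_ i (mem_index_enum _))/eqP.
exact: ip_ge0.
Qed.

(** The hypothesis says that V^* e is orthogonal to the initial space, so V
    V^* e = 0, and the norm of V^* e is zero. *)
Lemma adj_eq0_of_orth e : (forall m, G m -> ip (row_op V m) e = 0) ->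
  forall i, adj (V i) e = 0.
Proof.
move=> h; apply: (@sp_eq0 (Vs e)); rewrite -sp_adj kernel_row ?ip0l // => m Gm.
by rewrite -sp_adj h.
Qed.

(** For m in the initial space, V^* V m = m.  Indeed g = V^* V m - m is
    orthogonal to the initial space, so V g = 0, which makes <g, g> = - <g,
    m>, and this is zero because V is isometric at m. *)
Lemma partial_isometry_ip m f : G m -> ip (row_op V m) (row_op V f) = sp m f.
Proof.
move=> Gm; have Gm' := lspan_sub Gm.
pose g : 'I_d -> K := fun i => Vs (row_op V m) i - m i.
have gE : g = Vs (row_op V m) + (-1) *: m.
  by apply/funext => i; rewrite !fctE scaleN1r.
have Vg : row_op V g = 0.
  apply: kernel_row => a Ga; rewrite gE spDr spZr -sp_adj isom //.
    by rewrite mulN1r subrr.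
  exact: lspan_sub.
have g0 i : g i = 0.
  apply: sp_eq0; rewrite {2}gE spDr spZr -sp_adj Vg ip0l add0r mulN1r.
  rewrite gE spDl spZl rmorphN1 mulN1r sp_conj -sp_adj isom //.
  by rewrite -sp_conj subrr oppr0.
have Vm : Vs (row_op V m) = m.
  by apply/funext => i; apply/eqP; rewrite -subr_eq0; apply/eqP/g0.
by rewrite ip_conj sp_adj Vm -sp_conj.
Qed.

(** V^* V f - f is orthogonal to the initial space, so V V^* V f = V f, and
    |f|^2 - |V f|^2 is the square norm of V^* V f - f. *)
Lemma partial_isometry_contraction : row_contraction V.
Proof.
move=> f; pose g := Vs (row_op V f); pose h := g + (-1) *: f.
have Vh : row_op V h = 0.
  apply: kernel_row => m Gm; rewrite spDr spZr -sp_adj partial_isometry_ip //.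
  by rewrite mulN1r subrr.
have Vg : row_op V g = row_op V f.
  apply/eqP; rewrite -subr_eq0; apply/eqP; rewrite -Vh rowD rowZ scaleN1r //.
have gg : sp g g = ip (row_op V f) (row_op V f) by rewrite -sp_adj Vg.
have gf : sp f g = ip (row_op V f) (row_op V f) by rewrite -sp_adj.
have h0 : 0 <= sp h h by apply: sumr_ge0 => i _; exact: ip_ge0.
have : sp h h = sp f f - ip (row_op V f) (row_op V f).
  rewrite /h !spDl !spDr !spZl !spZr gg gf rmorphN1 [sp g f]sp_conj gf -ip_conj.
  ring.
move=> hE; rewrite hE subr_ge0 in h0.
have -> : \sum_i nm (f i) ^+ 2 = complex.Re (sp f f).
  by rewrite raddf_sum; apply: eq_bigr => i _; rewrite nm_sq.
by rewrite nm_sq; move: h0; rewrite lecE => /andP[].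
Qed.

End PartialIsometry.

(** * Operator systems and completely positive maps *)

Section OperatorSpaces.
Variable R : realType.
Implicit Types U V : hilbertType R.

Lemma opclosureP U V (X : set (U -> V)) f : opclosure X f <-> bop f /\
  forall e : R, 0 < e -> exists2 g, X g & forall x, nm (f x - g x) <= e * nm x.
Proof.
have E (e : R) (g : U -> V) x :
    (`|f x - g x| <= e%:C * `|x|) = (nm (f x - g x) <= e * nm x).
  by rewrite !nmE -rmorphM lecR.
by split=> -[bf h]; split=> // e e0; have [g Xg gP] := h e e0; exists g => // x;
  have := gP x; rewrite E.
Qed.

Lemma opclosure_sub U V (X : set (U -> V)) :
  X `<=` bop (V:=V) -> X `<=` opclosure X.
Proof.
move=> bX f Xf; apply/opclosureP; split=> [|e e0]; first exact: bX.
by exists f => // x; rewrite subrr nm0 mulr_ge0 ?nm_ge0 // ltW.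
Qed.

Lemma opclosure_mono U V (X Y : set (U -> V)) :
  X `<=` Y -> opclosure X `<=` opclosure Y.
Proof.
move=> XY f [bf h]; split=> // e e0; have [g Xg gP] := h e e0.
by exists g => //; exact: XY.
Qed.

Lemma opclosure_subspace U V (X : set (U -> V)) :
  subspace X -> subspace (opclosure X).
Proof.
move=> [X0 Xl]; split=> [|c f g /opclosureP[bf fX] /opclosureP[bg gX]].
  apply/opclosureP; split=> [|e e0].
    apply/bopP; split=> [c x y|]; first by rewrite scaler0 addr0.
    by exists 0 => // x; rewrite nm0 mul0r.
  by exists 0 => // x; rewrite subrr nm0 mulr_ge0 ?nm_ge0 // ltW.
apply/opclosureP; split=> [|e e0]; first exact: bop_linC.
have c1 : 0 < cm c + 1 by rewrite ltr_wpDl ?cm_ge0.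
have e1 : 0 < e / (cm c + 1) by rewrite divr_gt0.
have [f' Xf ff] := fX _ e1; have [g' Xg gg] := gX _ e1.
exists (c *: f' + g') => [|x]; first exact: Xl.
rewrite !fctE opprD addrACA -scalerBr (le_trans (nmD _ _)) // nmZc.
have -> : e = cm c * (e / (cm c + 1)) + e / (cm c + 1).
  by field; rewrite gt_eqF.
by rewrite mulrDl -mulrA lerD // ler_wpM2l ?cm_ge0.
Qed.

Definition operator_space U (X : set (U -> U)) :=
  [/\ X `<=` bop (V:=U), X id & subspace X].

Lemma opsys_space U (X : set (U -> U)) : operator_space X ->
  [/\ operator_space (opsys X), X `<=` opsys X &
      forall f, opsys X f -> opsys X (adj f)].
Proof.
move=> [bX X1 sX]; pose Y := [set a + adj c | a in X & c in X].
have bY : Y `<=` bop (V:=U).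
  move=> _ [a Xa [c Xc <-]]; rewrite -[a]scale1r; apply: bop_linC; first exact: bX.
  exact/adj_bop/bX.
have adj0 : adj (0 : U -> U) = 0.
  by apply: adj_eq => x y; rewrite ip0l ip0r.
have XY : X `<=` Y.
  by move=> a Xa; exists a => //; exists 0; [case: sX|rewrite adj0 addr0].
have sY : subspace Y.
  split; first by apply: XY; case: sX.
  move=> k _ _ [a Xa [c Xc <-]] [a' Xa' [c' Xc' <-]].
  exists (k *: a + a'); first by apply: sX.2.
  exists (k^* *: c + c'); first by apply: sX.2.
  rewrite adj_linC ?conjCK; [|exact: bX..].
  by rewrite scalerDr addrACA.
split; first split.
- by move=> f /opclosureP[].
- exact/(opclosure_sub bY)/XY.
- exact: opclosure_subspace.
- by move=> a Xa; apply/(opclosure_sub bY)/XY.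
move=> f /opclosureP[bf fY]; apply/opclosureP; split=> [|e e0].
  exact: adj_bop.
have [g Yg fg] := fY _ e0; exists (adj g) => [|x].
  have [a Xa [c Xc <-]] := Yg; exists c => //; exists a => //.
  have bc := bX _ Xc; have := adj_linC 1 (bX _ Xa) (adj_bop bc).
  by rewrite scale1r rmorph1 scale1r adjK // => ->; rewrite addrC.
have -> : adj f x - adj g x = adj (f - g) x.
  have := adj_linC (-1) (bY _ Yg) bf.
  by rewrite rmorphN1 !scaleN1r ![- _ + _]addrC => ->.
apply: nm_adj => //; last exact: ltW.
by have := bop_linC (-1) (bY _ Yg) bf; rewrite scaleN1r addrC.
Qed.

End OperatorSpaces.

Section CompletelyPositive.
Variables (R : realType) (U H : hilbertType R) (E : set (U -> U)).
Hypothesis sE : operator_space E.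
Hypothesis adjE : forall f, E f -> E (adj f).

Section Bounds.
Variable phi : (U -> U) -> H -> H.
Hypothesis cp : completely_positive E phi.

Lemma cp_sub f g : E f -> E g -> phi (f - g) = phi f - phi g.
Proof.
move=> Ef Eg; have [_ lphi _] := cp.
by have := lphi (-1) g f Eg Ef; rewrite !scaleN1r ![- _ + _]addrC.
Qed.

(** The 2 by 2 matrix with r on the diagonal and a, a^* off it is positive
    when |a| <= r.  Its image under phi is positive at the vector (y1, y2). *)
Lemma cp_pair a (r : R) y1 y2 : E a -> 0 <= r ->
  (forall x, nm (a x) <= r * nm x) ->
  0 <= r%:C * ip y1 (phi id y1) + ip y1 (phi a y2) +
       (ip y2 (phi (adj a) y1) + r%:C * ip y2 (phi id y2)).
Proof.
move=> Ea r0 ar; have [bE E1 sE'] := sE; have [_ lphi pphi] := cp.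
have E0 : E 0 by case: sE'.
have phi0 : phi 0 = 0 by have := cp_sub E1 E1; rewrite !subrr.
have phir : phi (r%:C *: id) = r%:C *: phi id.
  by rewrite -[_ *: id]addr0 lphi // phi0 addr0.
have [rI [ErI phirI rIE]] : exists rI : U -> U,
    [/\ E rI, phi rI = r%:C *: phi id & forall x, rI x = r%:C *: x].
  by exists (r%:C *: id); split=> //; exact: (subspaceZ r%:C sE' E1).
pose m (i j : 'I_2) : U -> U :=
  if i == j then rI else if i == 0 then a else adj a.
have := pphi 2%N m _ _ (fun i => if i == 0 then y1 else y2).
rewrite !big_ord_recl !big_ord0 /m /= !addr0 phirI !fctE !ipZr; apply.
  move=> i j; case: ifP => _ //.
  by case: ifP => _ //; exact: adjE.
move=> x; rewrite !big_ord_recl !big_ord0 /= !addr0.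
set x1 := x _; set x2 := x _.
rewrite !rIE !ipZr [ip x2 (adj a x1)]ip_conj adjPl; last exact: bE.
rewrite !ipxx -!rmorphM.
set c := ip x1 (a x2).
have -> : (r * nm x1 ^+ 2)%:C + c + (c^* + (r * nm x2 ^+ 2)%:C) =
   (r * nm x1 ^+ 2 + r * nm x2 ^+ 2 + 2 * complex.Re c)%:C.
  have cc : c + c^* = (2 * complex.Re c)%:C.
    by rewrite rmorphM rmorph_nat; exact: addcJ.
  rewrite [RHS]rmorphD [X in _ = X + _]rmorphD /= -cc; ring.
rewrite ler0c.
have : complex.Re (- c) <= r * (nm x1 * nm x2).
  rewrite (le_trans (cm_Re _)) // cmN (le_trans (cauchy_schwarz _ _)) //.
  by rewrite mulrCA ler_wpM2l ?nm_ge0.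
rewrite raddfN /=; have := sqr_ge0 (nm x1 - nm x2).
move: (complex.Re c) (nm x1) (nm x2) => p q s h1 h2; nra.
Qed.

Lemma operator_bound a :
  E a -> exists2 r : R, 0 <= r & forall x, nm (a x) <= r * nm x.
Proof. by case: sE => bE _ _ /bE/bopP[]. Qed.

(** The diagonal entries of the image in [cp_pair] are real, so the imaginary
    parts of the other two cancel. *)
Let Re_pair a (r : R) y1 y2 : E a -> 0 <= r -> (forall x, nm (a x) <= r * nm x) ->
  complex.Im (ip y1 (phi a y2)) + complex.Im (ip y2 (phi (adj a) y1)) = 0 /\
  0 <= r * complex.Re (ip y1 (phi id y1)) + complex.Re (ip y1 (phi a y2)) +
       (complex.Re (ip y2 (phi (adj a) y1)) + r * complex.Re (ip y2 (phi id y2))).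
Proof.
move=> Ea r0 ar.
have d y : complex.Im (r%:C * ip y (phi id y)) = 0.
  have := cp_pair y 0 Ea r0 ar; have [bE E1 _] := sE.
  have [bphi _ _] := cp.
  have [la _] := bphi _ Ea; have [l1 _] := bphi _ E1.
  rewrite !ip0l (lin0 la) ip0r mulr0 !addr0 lecE => /andP[/eqP-> _] //.
have dR y : complex.Re (r%:C * ip y (phi id y)) = r * complex.Re (ip y (phi id y)).
  by case: (ip _ _) => p q; rewrite /= mul0r subr0.
have := cp_pair y1 y2 Ea r0 ar; rewrite lecE !raddfD /= => /andP[/eqP].
by rewrite !d !dR add0r addr0 => <- h; split.
Qed.

(** Reality of phi a paired with phi (a^* ), at y2 and at i y2, determines one
    from the other. *)
Lemma cp_adj a : E a -> phi (adj a) = adj (phi a).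
Proof.
move=> Ea; have [r r0 ar] := operator_bound Ea.
have [bphi _ _] := cp.
have ba := bphi _ Ea; have ba' := bphi _ (adjE Ea).
apply/esym/adj_eq => y2 y1.
have [h1 _] := Re_pair y1 y2 Ea r0 ar.
have [h2 _] := Re_pair y1 ('i%C *: y2) Ea r0 ar.
move: h1 h2; rewrite (linZ _ _ ba.1) ipZr ipZl [ip (phi a y2) y1]ip_conj.
move: (ip _ _) (ip _ _) => [p q] [s t] /= h1 h2.
apply/eqP; rewrite eq_complex /=.
by apply/andP; split; apply/eqP; move: h1 h2; simpc => *; lra.
Qed.

(** Positivity in [cp_pair] at (- y1, y2), once phi (a^* ) is the adjoint of
    phi a. *)
Lemma cp_bound a (r : R) y1 y2 :
  E a -> 0 <= r -> (forall x, nm (a x) <= r * nm x) ->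
  2 * complex.Re (ip y1 (phi a y2)) <=
  r * (complex.Re (ip y1 (phi id y1)) + complex.Re (ip y2 (phi id y2))).
Proof.
move=> Ea r0 ar; have [bphi _ _] := cp.
have [E0 E1 _] := sE; have ba := bphi _ Ea; have b1 := bphi _ E1.
have [_] := Re_pair (- y1) y2 Ea r0 ar.
rewrite cp_adj // -adjP // [ip (phi a y2) _]ip_conj ReJ.
rewrite -scaleN1r (linZ _ _ b1.1) scaleN1r scaleN1r !ipNl !ipNr opprK raddfN /=.
by move: (complex.Re _) (complex.Re _) (complex.Re _) => *; lra.
Qed.

End Bounds.

(** If g in X is close to a, then phi a - psi a = phi (a - g) - psi (a - g),
    and both terms are small by [cp_bound]. *)
Lemma cp_agree (phi psi : (U -> U) -> H -> H) (X : set (U -> U)) :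
  completely_positive E phi -> completely_positive E psi ->
  X `<=` E -> (forall a, X a -> phi a = psi a) ->
  forall a, E a -> opclosure X a -> phi a = psi a.
Proof.
move=> cphi cpsi XE h a Ea /opclosureP[ba aX]; have [bE E1 sE'] := sE.
apply/funext => y; apply/eqP; rewrite -subr_eq0; apply/eqP.
set v := phi a y - psi a y.
apply/nm_eq0/eqP; rewrite -sqrf_eq0 eq_le sqr_ge0 andbT.
pose C (f : (U -> U) -> H -> H) z :=
  complex.Re (ip z (f id z)) + complex.Re (ip y (f id y)).
have C0 (f : (U -> U) -> H -> H) z : completely_positive E f -> 0 <= C f z.
  move=> cf; have n1 : forall x : U, nm (@id U x) <= 1 * nm x.
    by move=> x; rewrite mul1r.
  have := cp_bound cf z y E1 ler01 n1; have := cp_bound cf (- z) y E1 ler01 n1.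
  have [bf _ _] := cf; have b1 := bf _ E1.
  rewrite -scaleN1r (linZ _ _ b1.1) !scaleN1r !ipNl !ipNr opprK raddfN /= /C.
  by move: (complex.Re _) (complex.Re _) (complex.Re _) => *; lra.
apply: (@le_eps _ _ (C phi v + C psi (- v))); first by rewrite addr_ge0 ?C0.
move=> e e0; have [g Xg ag] := aX e e0.
have Eg := XE _ Xg; have Eag : E (a - g) by exact: subspaceB.
have ag' x : nm ((a - g) x) <= e * nm x by exact: ag.
have := cp_bound cphi v y Eag (ltW e0) ag'.
have := cp_bound cpsi (- v) y Eag (ltW e0) ag'.
have e1 : ip v (phi (a - g) y) = ip v (phi a y) - ip v (psi g y).
  by rewrite (cp_sub cphi) // !fctE ipBr (h g Xg).
have e2 : ip (- v) (psi (a - g) y) = ip v (psi g y) - ip v (psi a y).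
  by rewrite (cp_sub cpsi) // !fctE ipBr !ipNl opprK addrC.
have e3 : nm v ^+ 2 = complex.Re (ip v (phi a y) - ip v (psi a y)).
  by rewrite nm_sq {2}/v ipBr.
rewrite -/(C psi (- v)) -/(C phi v) e1 e2 e3.
move: (C0 phi v cphi) (C0 psi (- v) cpsi); move: (C psi (- v)) (C phi v) => c2 c1.
rewrite !raddfB /=; move: (complex.Re _) (complex.Re _) (complex.Re _) => p q s.
move=> c10 c20 h2 h1.
have ec1 : 0 <= e * c1 by rewrite mulr_ge0 // ltW.
have ec2 : 0 <= e * c2 by rewrite mulr_ge0 // ltW.
rewrite mulrDr; lra.
Qed.

End CompletelyPositive.

(** * Creation operators and their resolvents *)

Section FockOperators.
Variables (R : realType) (d : nat) (F : @fock R d).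
Local Notation L := (@fock_L R d F).
Local Notation A := (fock_A (F := F)).
Local Notation S := (fock_S (F := F)).
Implicit Types z w : 'rV[R[i]]_d.

(** The intersection of all closed algebras containing the L i is one,
    provided there are any; the algebra of all bounded operators is. *)
Lemma fock_A_algebra : unital_closed_algebra A.
Proof.
have bopA : unital_closed_algebra (bop (U := F) (V := F)).
  split=> //; [exact: bop_id|exact: bop_linC|exact: bop_comp|by move=> f /opclosureP[]].
split.
- move=> f; apply; split=> // _ [i _ <-]; exact: fock_L_bounded.
- by move=> X [[_ X1 _ _ _] _].
- move=> c f g Af Ag X XP; case: (XP) => -[_ _ Xl _ _] _.
  by apply: Xl; [exact: Af|exact: Ag].
- move=> f g Af Ag X XP; case: (XP) => -[_ _ _ Xc _] _.
  by apply: Xc; [exact: Af|exact: Ag].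
- move=> f Af X XP; case: (XP) => -[_ _ _ _ Xo] _; apply: Xo.
  by apply: opclosure_mono Af => g; exact.
Qed.

Lemma fock_A_L i : A (L i).
Proof. by move=> X [_]; apply; exists i. Qed.

Lemma fock_A_space : operator_space A.
Proof.
have [Ab A1 Al _ _] := fock_A_algebra; split=> //; split=> //.
by have := Al (-1) _ _ A1 A1; rewrite scaleN1r addNr.
Qed.

Lemma fock_A_comp f g : A f -> A g -> A (f \o g).
Proof. by case: fock_A_algebra => _ _ _ + _; apply. Qed.

Lemma fock_A_opword a : A (opword L a).
Proof.
elim: a => [|i a IH]; first by case: fock_A_space.
by apply: fock_A_comp => //; exact: fock_A_L.
Qed.

Lemma fock_A_op_conj z : A (op_conj L z).
Proof.
have [_ _ sA] := fock_A_space.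
by apply: (subspace_sum _ sA) => i _; apply: (subspaceZ _ sA); exact: fock_A_L.
Qed.

Lemma fock_L_linear i : linear (L i).
Proof. by case: (fock_L_bounded F i). Qed.

Lemma fock_L_row_isometry : row_isometry L.
Proof.
apply: (@row_isometry_total _ _ _ _ (range (fock_e F))).
- exact: fock_L_bounded.
- exact: fock_total.
- move=> i j _ _ [a _ <-] [c _ <-]; rewrite !fock_LE !fock_ortho eqseq_cons.
  by case: (i == j); rewrite ?mul1r ?mul0r.
Qed.

Lemma fock_L_contraction : row_contraction L.
Proof. exact/row_isometry_contraction/fock_L_row_isometry. Qed.

Definition szego z : F -> F := opinv (id - op_conj L z).

Let neumannL z : unit_ball z -> [/\ bop (szego z),
  forall x, szego z x = x + op_conj L z (szego z x) &
  forall n x, nm (szego z x - neumann_sum (op_conj L z) n x) <=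
              radius z ^+ n * (1 - radius z)^-1 * nm x].
Proof.
move=> zB; apply: opinv_neumann.
- exact: op_conj_linear fock_L_linear z.
- exact: radius_ge0.
- exact: radius_lt1.
- by move=> x; apply: nm_op_conj; [exact: fock_L_linear|exact: fock_L_contraction].
Qed.

Lemma szego_fix z : unit_ball z -> szego z = id + (op_conj L z \o szego z).
Proof. by move=> zB; apply/funext => x; have [_ + _] := neumannL zB; apply. Qed.

(** The resolvent is a norm limit of the partial sums of its Neumann series. *)
Lemma fock_A_szego z : unit_ball z -> A (szego z).
Proof.
move=> zB; have [bz _ az] := neumannL zB.
have [Ab A1 Al Ac Ao] := fock_A_algebra; have [_ _ sA] := fock_A_space.
have AN n : A (neumann_sum (op_conj L z) n).
  elim: n => [|n IH]; first by case: sA.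
  apply: (subspaceD sA) => //; apply: Ac => //; exact: fock_A_op_conj.
apply: Ao; apply/opclosureP; split=> [|e e0]; first exact: bz.
have r0 := radius_ge0 z; have r1 := radius_lt1 zB.
have q0 : 0 < 1 - radius z by rewrite subr_gt0.
have [N hN] := expr_small r0 r1 (mulr_gt0 e0 q0).
exists (neumann_sum (op_conj L z) N) => // x.
rewrite (le_trans (az N x)) // ler_wpM2r ?nm_ge0 // ler_pdivrMr //.
exact: ltW (hN _ (leqnn N)).
Qed.

Lemma unit_ball0 : unit_ball (0 : 'rV[R[i]]_d).
Proof.
by rewrite /unit_ball /= /dotC big1 ?ltr01 // => i _; rewrite mxE mul0r.
Qed.

Lemma op_conj0 (U : hilbertType R) (T : 'I_d -> U -> U) : op_conj T 0 = 0.
Proof. by rewrite /op_conj big1 // => i _; rewrite mxE rmorph0 scale0r. Qed.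

Lemma szego0 : szego 0 = id.
Proof.
rewrite (szego_fix unit_ball0) op_conj0; apply/funext => x.
by rewrite fctE /= addr0.
Qed.

Lemma lspan_szego_sub_A :
  lspan [set opinv (id - op_conj L z) | z in @unit_ball R d] `<=` A.
Proof.
apply: lspan_min; first by case: fock_A_space.
by move=> _ [z zB <-]; exact: fock_A_szego.
Qed.

Lemma fock_S_space : operator_space S.
Proof.
have [Ab _ _] := fock_A_space.
split.
- by move=> f /opclosureP[].
- apply: opclosure_sub; first by move=> f /lspan_szego_sub_A/Ab.
  by apply: lspan_sub; exists 0; [exact: unit_ball0|exact: szego0].
- exact/opclosure_subspace/lspan_subspace.
Qed.

Lemma fock_S_sub_A : S `<=` A.
Proof.
have [Ab A1 Al Ac Ao] := fock_A_algebra.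
by move=> f fS; apply: Ao; exact: opclosure_mono lspan_szego_sub_A _ fS.
Qed.

Lemma opsys_S_sub_A : opsys S `<=` opsys A.
Proof.
apply: opclosure_mono => _ [a Sa [c Sc <-]].
by exists a; [exact: fock_S_sub_A|exists c; [exact: fock_S_sub_A|]].
Qed.

Lemma completely_positive_sub (U H : hilbertType R) (E E' : set (U -> U))
    (phi : (U -> U) -> H -> H) : E' `<=` E ->
  completely_positive E phi -> completely_positive E' phi.
Proof.
move=> EE [b l p]; split=> [a /EE|c a a' /EE Ea /EE|n a Ea]; [exact: b|exact: l|].
by apply: p => i j; exact/EE/Ea.
Qed.

(** Agreement passes from the resolvents to their span, to its closure, to
    sums a + c^* by [cp_adj], and to the closure of those. *)
Lemma cp_agree_S (H : hilbertType R) (phi psi : (F -> F) -> H -> H) :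
  completely_positive (opsys A) phi -> completely_positive (opsys S) psi ->
  (forall z, unit_ball z -> phi (szego z) = psi (szego z)) ->
  forall a, opsys S a -> phi a = psi a.
Proof.
move=> /(completely_positive_sub opsys_S_sub_A) cphi cpsi h.
have [sE SE adjE] := opsys_space fock_S_space.
have agree := cp_agree sE adjE cphi cpsi.
have lin0 (f : (F -> F) -> H -> H) : completely_positive (opsys S) f ->
    f 0 = 0 /\ forall a c, opsys S a -> opsys S c -> f (a + c) = f a + f c.
  move=> cf; have [_ E1 sE'] := sE; have [_ l _] := cf; split.
    by have := cp_sub cf E1 E1; rewrite !subrr.
  by move=> a c Ea Ec; rewrite -[a]scale1r l // !scale1r.
have [phi0 phiD] := lin0 _ cphi; have [psi0 psiD] := lin0 _ cpsi.
have sub : lspan [set opinv (id - op_conj L z) | z in @unit_ball R d] `<=`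
           [set a | opsys S a /\ phi a = psi a].
  have [_ E1 sE'] := sE.
  apply: lspan_min => [|_ [z zB <-]]; last first.
    split; last exact: h.
    apply/SE/opclosure_sub => [f|]; last by apply: lspan_sub; exists z.
    by have [Ab _ _] := fock_A_space; move=> /lspan_szego_sub_A/Ab.
  split=> [|c a a' [Ea ea] [Ea' ea']]; first by split; [case: sE'|rewrite phi0].
  split; first by apply: sE'.2.
  by have [_ l1 _] := cphi; have [_ l2 _] := cpsi; rewrite l1 // l2 // ea ea'.
have onS a : S a -> phi a = psi a.
  move=> Sa; apply: (agree _ _ _ _ (SE _ Sa) Sa); first by move=> f /sub[].
  by move=> f /sub[].
move=> a Ea; apply: (agree _ _ _ _ Ea Ea).
  move=> _ [x Sx [y Sy <-]]; have [_ _ sE'] := sE.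
  by apply: subspaceD => //; [exact: SE|exact/adjE/SE].
move=> _ [x Sx [y Sy <-]]; have Ex := SE _ Sx; have Ey := SE _ Sy.
have Ey' := adjE _ Ey.
by rewrite phiD // psiD // (cp_adj sE adjE cphi) // (cp_adj sE adjE cpsi) // !onS.
Qed.

End FockOperators.

Arguments szego {R d} F z _.
Arguments szego_fix {R d} F [z].
Arguments szego0 {R d} F.
Arguments fock_A_szego {R d} F [z].
Arguments fock_A_space {R d} F.

(** * Inner products of resolvent vectors *)

Section Kernels.
Variables (R : realType) (d : nat).
Implicit Types (z w : 'rV[R[i]]_d).

Lemma dotC_neq1 z w : unit_ball z -> unit_ball w -> 1 - dotC z w != 0.
Proof.
move=> zB wB; rewrite subr_eq0; apply/eqP => /(congr1 cm) e.
have sq (x : 'rV[R[i]]_d) : \sum_i cm (x 0 i) ^+ 2 = radius x ^+ 2.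
  by rewrite sqr_sqrtr // sumr_ge0 // => i _; exact: sqr_ge0.
have rad1 (x : 'rV[R[i]]_d) : unit_ball x -> radius x ^+ 2 < 1.
  by move=> /radius_lt1 xr; rewrite exprn_ilt1 // radius_ge0.
have cm_sum (f : 'I_d -> R[i]) : cm (\sum_i f i) <= \sum_i cm (f i).
  exact: (@nm_sum R R[i]^o).
have : cm (dotC z w) <= (radius z ^+ 2 + radius w ^+ 2) / 2.
  rewrite (le_trans (cm_sum _)) // -!sq -big_split /= mulr_suml.
  apply: ler_sum => i _; rewrite cmM cmJ.
  have := sqr_ge0 (cm (z 0 i) - cm (w 0 i)).
  by move: (cm _) (cm _) => p q; nra.
rewrite -e (_ : (1 : R[i]) = 1%:C) // cmR normr1.
have := rad1 _ zB; have := rad1 _ wB; move: (_ ^+ 2) (_ ^+ 2) => *; lra.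
Qed.

(** Applied to u = k_z h and v = k_w g with a = R (z^* k_z h), e = R (w^* k_w
    g) and c = z w^*: the inner products of the k are determined by those with
    k_0. *)
Lemma kernel_equation (U : hilbertType R) (c : R[i]) (u0 u v0 v a e : U) :
  u = u0 + a -> v = v0 + e -> ip a e = c * ip u v ->
  (1 - c) * ip u v = ip u0 v + ip u v0 - ip u0 v0.
Proof.
move=> uE vE ae.
have h1 : ip u v = ip u0 v + ip a v by rewrite {1}uE ipDl.
have h2 : ip a v = ip a v0 + ip a e by rewrite {1}vE ipDr.
have h3 : ip u v0 = ip u0 v0 + ip a v0 by rewrite {1}uE ipDl.
rewrite mulrBl mul1r -ae h3 {1}h1 h2; ring.
Qed.

Lemma row_isometry_op_conj (U : hilbertType R) (T : 'I_d -> U -> U) w i x q :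
  row_isometry T -> ip (op_conj T w x) (T i q) = w 0 i * ip x q.
Proof.
move=> iT; rewrite op_conjE ip_suml (bigD1 i) //= ipZl conjCK iT eqxx mul1r.
by rewrite big1 ?addr0 // => j /negbTE ji; rewrite ipZl iT ji mul0r mulr0.
Qed.

(** Lets statements about rows, such as [partial_isometry_ip], be applied to a
    single V i. *)
Lemma row_op_single (U : hilbertType R) (T : 'I_d -> U -> U) i x :
  (forall j, linear (T j)) ->
  row_op T (fun j => if j == i then x else 0) = T i x.
Proof.
move=> lT; rewrite /row_op (bigD1 i) //= eqxx big1 ?addr0 // => j /negbTE ->.
exact: lin0.
Qed.

End Kernels.

(** * The Herglotz space inside the GNS space *)

Section Main.
Variables (R : realType) (d : nat) (H : hilbertType R) (F : @fock R d).
Variables (b : 'rV[R[i]]_d -> H -> H) (Lb : rkhs (herglotz_kernel b)).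
Variables (V : 'I_d -> Lb -> Lb) (nu : (F -> F) -> H -> H) (Q : Q2 nu).
Hypothesis HV : is_herglotz_row V.
Hypothesis Hnu : is_nu V nu.
Implicit Types (w z : 'rV[R[i]]_d) (g h : H).

(** In the comments 1 tensor h is [one h], k_w h is [k w h] and R_j is [piL j]. *)
Local Notation L := (@fock_L R d F).
Local Notation A := (@fock_A R d F).
Local Notation K := (rk_fun Lb).
Local Notation tens := (q2_tens Q).
Local Notation k w h := (q2_tens Q (szego F w) h).
Local Notation one h := (q2_tens Q id h).
Local Notation piL := (q2_L Q).

Let V_bounded j : bop (V j). Proof. by case: HV. Qed.
Let V_linear j : linear (V j). Proof. by case: (V_bounded j). Qed.
Let V_partial_isometry :
  partial_isometry_with_initial_space V (herglotz_initial_space (Lb := Lb)).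
Proof. by case: HV. Qed.

Let ip_kernel w h f : unit_ball w -> ip (K w h) f = ip h (rk_eval w f).
Proof. by move=> wB; rewrite adjPl //; exact: rk_bounded. Qed.

Let adj_kernel0 : adj (K 0) = rk_eval 0.
Proof. by rewrite adjK //; apply/rk_bounded/unit_ball0. Qed.

(** The defining relation of V at w^* K_w h. *)
Let kernel_fixpoint w h : unit_ball w -> K w h = K 0 h + op_conj V w (K w h).
Proof.
move=> wB; rewrite op_conj_row //; have [_ _ ->] := HV => //.
by rewrite addrC subrK.
Qed.

Let kernel_index := ({w : 'rV[R[i]]_d | unit_ball w} * H)%type.
Let kernel_vector (p : kernel_index) : Lb := K (sval p.1) p.2.
Let szego_vector (p : kernel_index) : Q := k (sval p.1) p.2.

(** <K_w h, f> = <h, f(w)>, and an element of the Herglotz space is determined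
    by its values. *)
Let kernel_separates f : (forall w h, unit_ball w -> ip (K w h) f = 0) -> f = 0.
Proof.
move=> hf; apply: rk_inj => z zB.
have [lz _] : bop (@rk_eval R d H _ Lb z) by exact: rk_bounded.
rewrite (lin0 lz); apply: ip_inj => h.
by rewrite ip0r -ip_kernel // hf.
Qed.

Let kernel_total : closed_span (range kernel_vector) = setT.
Proof.
apply/seteqP; split=> // x _; apply: biorthogonal => [|y hy].
  exact: closed_span_closed_subspace.
rewrite (kernel_separates (f := y)) ?ip0r // => w h wB.
by apply: hy; apply: closed_span_sub; exists (exist _ w wB, h).
Qed.

Let piL_bounded j : bop (piL j).
Proof. by apply: (q2_pi_bounded Q); exact: fock_A_L. Qed.
Let piL_linear j : linear (piL j). Proof. by case: (piL_bounded j). Qed.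

Let piL_tens j x h : A x -> piL j (tens x h) = tens (L j \o x) h.
Proof. by move=> Ax; rewrite /q2_L q2_piE //; exact: fock_A_L. Qed.

Let A1 : A id. Proof. by case: (fock_A_space F). Qed.

Let nu0 : nu 0 = 0.
Proof.
have [sE _ _] := opsys_space (fock_A_space F).
have [_ E1 _] := sE; have := cp_sub Hnu.1 E1 E1.
by rewrite !subrr.
Qed.

(** The relations L_i^* L_j = delta_ij pass to the inner product defined by
    nu. *)
Let piL_row_isometry : row_isometry piL.
Proof.
apply: (@row_isometry_total _ _ _ _ [set tens x h | x in A & h in setT]).
- exact: piL_bounded.
- exact: q2_dense.
move=> i j _ _ [x Ax [h _ <-]] [y Ay [g _ <-]].
have [bA _ _] := fock_A_space F.
have bx := bA _ Ax; have by_ := bA _ Ay; have bL := fock_L_bounded F.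
rewrite !piL_tens // !q2_ip //; [|by apply: fock_A_comp => //; exact: fock_A_L..].
have E : adj (L i \o x) \o (L j \o y) = (i == j)%:R *: (adj x \o y).
  apply/funext => v; apply: ip_inj => u; rewrite fctE /= ipZr.
  rewrite -!adjP // -?fock_L_row_isometry //; exact: bop_comp.
rewrite E; case: (i == j); first by rewrite scale1r mul1r.
by rewrite scale0r nu0 ip0r mul0r.
Qed.

Let V_contraction : row_contraction V.
Proof. exact: partial_isometry_contraction V_bounded V_partial_isometry. Qed.
Let piL_contraction : row_contraction piL.
Proof. exact: row_isometry_contraction piL_row_isometry. Qed.

Let tens_sum (I : Type) (r : seq I) (P : pred I) (c : I -> R[i])
    (f : I -> F -> F) h :
  (forall i, A (f i)) ->
  tens (\sum_(i <- r | P i) c i *: f i) h =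
  \sum_(i <- r | P i) c i *: tens (f i) h.
Proof.
move=> Af; have [_ _ sA] := fock_A_space F.
have t0 : tens 0 h = 0.
  have := q2_tens_linearl Q (-1) h A1 A1.
  by rewrite !scaleN1r !addNr.
elim: r => [|i r IH]; first by rewrite !big_nil.
rewrite !big_cons; case: ifP => // _.
rewrite q2_tens_linearl ?IH //.
by apply: (subspace_sum _ sA) => j _; apply: (subspaceZ _ sA).
Qed.

Let tens_opword a h : tens (opword L a) h = opword piL a (one h).
Proof.
elim: a => //= i a <-; rewrite piL_tens //; exact: fock_A_opword.
Qed.

Let tens_opsym n h : tens (opsym L n) h = opsym piL n (one h).
Proof.
have -> : opsym L n = \sum_(a : (\sum_i n i)%N.-tuple 'I_d |
    [forall i, count_mem i a == n i]) (1 : R[i]) *: opword L a.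
  by apply: eq_bigr => a _; rewrite scale1r.
rewrite tens_sum => [|a]; last exact: fock_A_opword.
rewrite /opsym fct_sumE; apply: eq_bigr => a _.
by rewrite scale1r tens_opword.
Qed.

(** The resolvent equation (I - L w^* )^{-1} = I + L w^* (I - L w^* )^{-1},
    tensored with h. *)
Let szego_vector_fixpoint w h : unit_ball w ->
  k w h = one h + op_conj piL w (k w h).
Proof.
move=> wB; have Aw := fock_A_szego F wB.
rewrite {1}(szego_fix F wB).
have -> : id + (op_conj L w \o szego F w) =
    (1 : R[i]) *: id + \sum_i (w 0 i)^* *: (L i \o szego F w).
  apply/funext => x; rewrite !fctE /= scale1r op_conjE fct_sumE.
  by congr (_ + _).
have AL i : A (L i \o szego F w) by apply: fock_A_comp => //; exact: fock_A_L.
have [_ _ sA] := fock_A_space F.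
rewrite q2_tens_linearl //; last first.
  by apply: (subspace_sum _ sA) => i _; apply: (subspaceZ _ sA).
rewrite scale1r tens_sum // op_conjE; congr (_ + _).
by apply: eq_bigr => i _; rewrite piL_tens.
Qed.

(** The values of nu on words, read in both spaces. *)
Let ip_vacuum_word a g h :
  ip (one h) (tens (opword L a) g) = ip (K 0 h) (opword V a (K 0 g)).
Proof.
rewrite q2_ip //; last exact: fock_A_opword.
rewrite adj_id (_ : id \o _ = opword L a) // Hnu.2 adj_kernel0 /= ip_kernel //.
exact: unit_ball0.
Qed.

(** Summed over words, [ip_vacuum_word] becomes this equality for resolvents. *)
Let ip_vacuum_szego w g h : unit_ball w -> ip (one h) (k w g) = ip (K 0 h) (K w g).
Proof.
move=> wB; apply: (neumann_ip_eq (op_conj_linear piL_linear w)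
  (op_conj_linear V_linear w) (radius_ge0 w) (radius_lt1 wB)).
- by move=> y; exact: nm_op_conj.
- by move=> y; exact: nm_op_conj.
- exact: szego_vector_fixpoint.
- exact: kernel_fixpoint.
move=> m; rewrite (iter_op_conj piL_linear) (iter_op_conj V_linear) !ip_sumr.
by apply: eq_bigr => a _; rewrite !ipZr -tens_opword ip_vacuum_word.
Qed.

Let initial_generator w h : unit_ball w ->
  [set f : 'I_d -> Lb | exists w h, unit_ball w /\
     f = fun j => (w 0 j)^* *: rk_fun Lb w h] (fun j => (w 0 j)^* *: K w h).
Proof. by move=> wB; exists w, h. Qed.

(** Both sides satisfy [kernel_equation] with the same right-hand side, and
    1 - z w^* is not zero. *)
Let szego_gram p q :
  ip (kernel_vector p) (kernel_vector q) = ip (szego_vector p) (szego_vector q).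
Proof.
move: p q => [[z zB] h] [[w wB] g]; rewrite /kernel_vector /szego_vector /=.
have nz := dotC_neq1 zB wB.
have sc (U : hilbertType R) (x y : U) :
    \sum_i ip ((z 0 i)^* *: x) ((w 0 i)^* *: y) = dotC z w * ip x y.
  by rewrite mulr_suml; apply: eq_bigr => i _; rewrite ipZl ipZr conjCK mulrA.
apply: (mulfI nz).
rewrite (kernel_equation (kernel_fixpoint h zB) (kernel_fixpoint g wB)); last first.
  rewrite !op_conj_row //.
  rewrite (partial_isometry_ip V_bounded V_partial_isometry _ (initial_generator _ zB)).
  exact: sc.
rewrite (kernel_equation (szego_vector_fixpoint h zB)
  (szego_vector_fixpoint g wB)); last first.
  by rewrite !op_conj_row // (row_isometry_ip _ _ piL_row_isometry) sc.
rewrite ip_vacuum_szego // [ip (k z h) _]ip_conj ip_vacuum_szego // -ip_conj.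
have := ip_vacuum_szego g h (@unit_ball0 R d); rewrite szego0 => ->.
by [].
Qed.

Let Gamma_exists := isometric_extension szego_gram kernel_total.
Let Gamma : Lb -> Q := projT1 (cid Gamma_exists).
Let Gamma_linear : linear Gamma. Proof. by rewrite /Gamma; case: cid => f []. Qed.
Let Gamma_isometry x y : ip (Gamma x) (Gamma y) = ip x y.
Proof. by rewrite /Gamma; case: cid => f []. Qed.
Let Gamma_kernel w h : unit_ball w -> Gamma (K w h) = k w h.
Proof.
by move=> wB; rewrite /Gamma; case: cid => f [_ _ +] /=; move/(_ (exist _ w wB, h)).
Qed.
Let Gamma_bounded : bop Gamma.
Proof.
apply/bopP; split=> //; exists 1 => // x; rewrite mul1r.
by rewrite (nm_eq_ip (Gamma_isometry x x)).
Qed.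

Let X : Q -> Lb := adj Gamma.
Let X_bounded : bop X. Proof. exact: adj_bop. Qed.
Let XGamma x : X (Gamma x) = x.
Proof. by apply: ip_inj => y; rewrite -adjP // Gamma_isometry. Qed.

(** Peel off the first letter i.  On both sides the part with K_0 or with 1
    tensor h is known from [ip_vacuum_word], and what remains is w_i times the
    same expression for the shorter word, because R_i^* R = (coordinate i) and
    V^* V fixes w^* K_w h. *)
Let ip_szego_word a w h g : unit_ball w ->
  ip (k w h) (tens (opword L a) g) = ip (K w h) (opword V a (K 0 g)).
Proof.
move=> wB; elim: a => [|i a IH].
  by rewrite /= ip_conj ip_vacuum_szego // -ip_conj.
rewrite {1}(szego_vector_fixpoint h wB) {1}(kernel_fixpoint h wB) !ipDl.
rewrite ip_vacuum_word; congr (_ + _).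
rewrite tens_opword /= -tens_opword.
rewrite (row_isometry_op_conj _ _ _ _ piL_row_isometry) IH.
rewrite op_conj_row // -(row_op_single i (opword V a (K 0 g)) V_linear).
rewrite (partial_isometry_ip V_bounded V_partial_isometry _ (initial_generator _ wB)).
rewrite (bigD1 i) //= eqxx ipZl conjCK.
by rewrite big1 ?addr0 // => j /negbTE ->; rewrite ip0r.
Qed.

Let X_word a g : X (tens (opword L a) g) = opword V a (K 0 g).
Proof.
apply/eqP; rewrite -subr_eq0; apply/eqP/kernel_separates => w h wB.
by rewrite ipBr -adjP // Gamma_kernel // ip_szego_word // subrr.
Qed.

(** The space on which X intertwines R with V; it is invariant under R and
    contains the range of Gamma. *)
Let words : set Q := closed_span [set x | exists a h, x = tens (opword L a) h].
Let words_closed_subspace : closed_subspace words.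
Proof. exact: closed_span_closed_subspace. Qed.

Let piL_words j x : words x -> words (piL j x).
Proof.
move: x; apply: closed_span_min; first exact: preimage_closed_subspace.
move=> _ [a [h ->]] /=; apply: closed_span_sub; exists (j :: a), h.
by rewrite piL_tens //; exact: fock_A_opword.
Qed.

Let X_intertwines j x : words x -> X (piL j x) = V j (X x).
Proof.
move: x; apply: (bop_eq_on_closed_span (f := X \o piL j) (g := V j \o X)).
- exact: bop_comp.
- exact: bop_comp.
move=> _ [a [h ->]] /=; rewrite X_word piL_tens; last exact: fock_A_opword.
exact: (X_word (j :: a)).
Qed.

Let szego_words w h : unit_ball w -> words (k w h).
Proof.
move=> wB; apply: (neumann_mem (op_conj_linear piL_linear w) (radius_ge0 w)
  (radius_lt1 wB) _ words_closed_subspace (szego_vector_fixpoint h wB)).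
  by move=> y; exact: nm_op_conj.
have [sW _] := words_closed_subspace.
elim=> [|m IH]; first by apply: closed_span_sub; exists [::], h.
rewrite iterS op_conjE; apply: subspace_sum => // i _.
by apply: (subspaceZ _ sW); exact: piL_words.
Qed.

Let Gamma_words y : words (Gamma y).
Proof.
have : closed_span (range kernel_vector) y by rewrite kernel_total.
move: y; apply: closed_span_min; first exact: preimage_closed_subspace.
move=> _ [[[w wB] h] _ <-]; rewrite /= /kernel_vector Gamma_kernel //=.
exact: szego_words.
Qed.

(** q minus Gamma X q is orthogonal to the range of Gamma, hence to all
    resolvent vectors, hence to the coefficients of their power series, and q
    is one of these coefficients. *)
Let GammaX_opsym n h : Gamma (X (tens (opsym L n) h)) = tens (opsym L n) h.
Proof.
set q := tens _ h; pose x := q - Gamma (X q).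
have xG y : ip x (Gamma y) = 0.
  apply: ip_eq0_sym; rewrite /x ipBr Gamma_isometry adjP //; exact: subrr.
have xk w g : unit_ball w -> ip x (k w g) = 0 by move=> wB; rewrite -Gamma_kernel.
have xiter m w : unit_ball w -> ip x (iter m (op_conj piL w) (one h)) = 0.
  move=> wB; have r1 := radius_lt1 wB; have r0 := radius_ge0 w.
  have scE (t : R) : op_conj piL (t%:C *: w) = fun y => t%:C *: op_conj piL w y.
    apply/funext => y; rewrite !op_conjE scaler_sumr; apply: eq_bigr => i _.
    by rewrite mxE rmorphM /= conjR scalerA.
  have scB (t : R) : 0 < t <= 2^-1 -> unit_ball (t%:C *: w).
    move=> /andP[/ltW t0 t1]; apply: unit_ball_scale => //.
    by rewrite t0 /= (le_trans t1) // invf_le1 ?ler1n ?ltr0n.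
  apply: (neumann_coef_eq0 (k := fun t => k (t%:C *: w) h)).
  - exact: op_conj_linear piL_linear w.
  - move=> y; apply: le_trans (nm_op_conj _ _ piL_linear piL_contraction) _.
    by rewrite ler_piMl ?nm_ge0 // ltW.
  - by move=> t tI; rewrite {1}(szego_vector_fixpoint h (scB t tI)) scE.
  - by move=> t tI; apply/xk/scB.
have xq : ip x q = 0.
  have := @word_coef_eq0 R d (\sum_i n i)%N (fun a => ip x (opword piL a (one h))).
  rewrite /q tens_opsym /opsym fct_sumE ip_sumr => /(_ _ n); apply=> w wB.
  rewrite -[RHS](xiter (\sum_i n i)%N w wB) (iter_op_conj piL_linear) ip_sumr.
  by apply: eq_bigr => a _; rewrite ipZr.
apply/esym/eqP; rewrite -subr_eq0; apply/eqP/ipxx_eq0.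
by rewrite -/x {2}/x ipBr xq xG subr0.
Qed.

Let P20_closed_subspace : closed_subspace (P20 (Q := Q)).
Proof. exact: closed_span_closed_subspace. Qed.

Let GammaX_P20 x : P20 x -> Gamma (X x) = x.
Proof.
move: x; apply: (bop_eq_on_closed_span (f := Gamma \o X) (g := id)).
- exact: bop_comp.
- exact: bop_id.
by move=> _ [n [h [_ ->]]] /=; exact: GammaX_opsym.
Qed.

(** The Neumann series without its constant term. *)
Let P20_szego_sub_vacuum w g : unit_ball w -> P20 (k w g - one g : Q).
Proof.
move=> wB.
have lSw := op_conj_linear piL_linear w.
have fixk : k w g - one g = op_conj piL w (one g) + op_conj piL w (k w g - one g).
  rewrite -(linD _ _ lSw) [one g + _]addrC subrK.
  by rewrite {1}(szego_vector_fixpoint g wB) addrC addKr.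
apply: (neumann_mem lSw (radius_ge0 w) (radius_lt1 wB) _ P20_closed_subspace fixk).
  by move=> y; exact: nm_op_conj.
move=> m; rewrite -iterSr; apply: (iter_op_conj_mem piL_linear w).
  by case: P20_closed_subspace.
move=> n nm1; apply: closed_span_sub; exists n, g; rewrite tens_opsym; split=> //.
apply: contrapT => /forallNP n0.
have : (\sum_i n i)%N = 0%N.
  by apply: big1 => i _; apply/eqP; move: (n0 i) => /negP; rewrite negbK.
by rewrite nm1.
Qed.

(** If e is orthogonal to P^2_0 then X e is orthogonal to (K_w - K_0) h = V
    (w^* K_w h), so that V_j^* X e = 0 for every j. *)
Let P20_Gamma_V j y : P20 (Gamma (V j y)).
Proof.
apply: biorthogonal => // e he.
rewrite adjP // adjP // (adj_eq0_of_orth V_bounded V_partial_isometry) ?ip0r //.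
move=> _ [w [h [wB ->]]]; have [_ _ ->] := HV => //.
rewrite -adjP // (linB _ _ Gamma_linear) !Gamma_kernel //; last exact: unit_ball0.
by rewrite szego0 he //; exact: P20_szego_sub_vacuum.
Qed.

(** The difference q - Gamma X q is orthogonal to the range of Gamma, which
    contains P^2_0. *)
Let P0_Gamma q : P20 (Gamma (X q)) -> P0 Q q = Gamma (X q).
Proof.
move=> Pq; apply: orthproj_eq => // m Pm.
by rewrite -(GammaX_P20 Pm) ipBr adjP // Gamma_isometry subrr.
Qed.

Let P0_P20 q : P20 (P0 Q q).
Proof. by case: (orthprojP q P20_closed_subspace). Qed.

Let P20_words q : P20 q -> words q.
Proof. by move=> /GammaX_P20 <-; exact: Gamma_words. Qed.

Let P0_piL_Gamma j y : P0 Q (piL j (Gamma y)) = Gamma (V j y).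
Proof.
have e : X (piL j (Gamma y)) = V j y.
  by rewrite X_intertwines ?XGamma //; exact: Gamma_words.
by rewrite P0_Gamma e.
Qed.

(** Both sides map q to Gamma V_l V_j y, where P_0 q = Gamma y. *)
Lemma semi_invariant j l : P0 Q \o piL l \o P0 Q \o piL j \o P0 Q =
  P0 Q \o piL l \o piL j \o P0 Q.
Proof.
apply/funext => q /=.
have [y ->] : exists y, P0 Q q = Gamma y by exists (X (P0 Q q)); rewrite GammaX_P20.
rewrite !P0_piL_Gamma.
have w1 : words (piL j (Gamma y)) by apply: piL_words; exact: Gamma_words.
have e : X (piL l (piL j (Gamma y))) = V l (V j y).
  by rewrite X_intertwines // X_intertwines ?XGamma //; exact: Gamma_words.
by rewrite P0_Gamma e.
Qed.

Lemma Q20_piL j x : Q20 (Q := Q) x -> Q20 (piL j x).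
Proof.
move: x; apply: closed_span_min.
  apply: preimage_closed_subspace => //; exact: closed_span_closed_subspace.
move=> _ [a [h [_ ->]]] /=; apply: closed_span_sub; exists (j :: a), h.
by rewrite piL_tens //; exact: fock_A_opword.
Qed.

Lemma P20_sub_Q20 x : P20 (Q := Q) x -> Q20 x.
Proof.
have cQ : closed_subspace (Q20 (Q := Q)) := @closed_span_closed_subspace _ _ _.
move: x; apply: closed_span_min => // _ [n [h [[j nj] ->]]].
rewrite tens_opsym /opsym fct_sumE; apply: subspace_sum; first by case: cQ.
move=> a /forallP an; rewrite /Q20; apply: closed_span_sub.
exists (a : seq _), h; rewrite tens_opword.
split=> //; apply: contra nj => /eqP a0.
by have := an j; rewrite a0 eq_sym.
Qed.

(** On x = Gamma y in P^2_0, each side at the word a is Gamma V^a y. *)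
Lemma tight_nu : tight Q.
Proof.
move=> a x Px.
have TE : opword (tight_T (Q := Q)) a x = opword piL a x /\ Q20 (opword piL a x).
  elim: a => [|i a [IH Qa]] /=; first by split=> //; exact: P20_sub_Q20.
  split; last exact: Q20_piL.
  by rewrite IH /tight_T patchT // inE.
have SE : opword (tight_S (Q := Q)) a x = Gamma (opword V a (X x)) /\
          P20 (Gamma (opword V a (X x))).
  elim: a {TE} => [|i a [IH Pa]] /=; first by rewrite GammaX_P20.
  split=> //.
  by rewrite IH /tight_S patchT ?inE //= P0_piL_Gamma.
have WE : words (opword piL a x) /\ X (opword piL a x) = opword V a (X x).
  elim: a {TE SE} => [|i a [IH e]] /=; first by split=> //; exact: P20_words.
  by split; [exact: piL_words|rewrite X_intertwines // e].
have [_ ex] := WE; have [-> _] := TE; have [-> Pa] := SE.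
by rewrite -ex in Pa *; rewrite P0_Gamma.
Qed.

(** The inner product of 1 tensor h with k_z g, computed from nu and by
    [ip_vacuum_szego]. *)
Lemma nu_szego z : unit_ball z -> nu (szego F z) = adj (K 0) \o K z.
Proof.
move=> zB; apply/funext => g; apply: ip_inj => h /=.
rewrite adj_kernel0 -ip_kernel; last exact: unit_ball0.
rewrite -ip_vacuum_szego // q2_ip //; last exact: fock_A_szego.
by rewrite adj_id.
Qed.

Lemma tight_extension_nu mu : is_mu b mu -> tight_extension Q mu.
Proof.
move=> [cmu muE]; split; [by case: Hnu| |exact: tight_nu].
apply: cp_agree_S => // [|z zB]; first by case: Hnu.
(* The prescribed value of mu at the pair (0, z) is its value at the resolvent
   of z. *)
have z0 := @unit_ball0 R d.
rewrite nu_szego // rk_kernel // -(muE _ _ z0 zB).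
have -> : conj_op L 0 = op_conj L 0.
  by rewrite op_conj0 /conj_op big1 // => i _; rewrite mxE scale0r.
by have := szego0 F; rewrite /szego => ->.
Qed.

End Main.

Theorem corollary3p9 (R : realType) (d : nat) (H : hilbertType R)
    (F : @fock R d)
    (b : 'rV[R[i]]_d -> H -> H) (Lb : rkhs (herglotz_kernel b))
    (V : 'I_d -> Lb -> Lb) (mu nu : (F -> F) -> H -> H) (Q : Q2 nu) :
  (0 < d)%N ->
  (exists h : H, h != 0) -> separable H ->
  in_multiplier_ball b -> purely_contractive b ->
  is_herglotz_row V -> is_mu b mu -> is_nu V nu ->
  (forall j k : 'I_d,
     P0 Q \o q2_L Q k \o P0 Q \o q2_L Q j \o P0 Q =
     P0 Q \o q2_L Q k \o q2_L Q j \o P0 Q) /\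
  tight_extension Q mu.
Proof.
move=> _ _ _ _ _ HV Hmu Hnu; split=> [j k|].
  exact: semi_invariant HV Hnu j k.
exact: tight_extension_nu HV Hnu mu Hmu.
Qed.
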